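(* Let $p<p'<2p$ be coprime positive integers, $1\le r\le p-1$, $1\le b,s\le p'-1$, $\lambda=|b-s|$, and let $N\ge1$, $0\le\ell<N$ be integers with $s+b+Nr+\ell$ even. Then $$\hat\chi^{(p',\,p'+Np;\,N)}_{s,\,b+Nr;\,\ell}(q)=q^{-\frac{\ell(N-\ell)+\lambda^2}{4N}}\sum_{\substack{m\in\mathbb{Z}_{\ge0}^N\\ m\equiv Q \,(\mathrm{mod}\,2)}}q^{\frac14 m^TT^{(N)}m}\;\prod_{j=1}^{N-1}\begin{bmatrix}m_j+n_j\\ m_j\end{bmatrix}\;\frac{F^{(p,p')}_{r,s}(m_N,b)}{(q)_{m_N}},$$ where $n$ is determined by $m+n=\frac12\bigl(\mathcal I_{T^{(N)}}m+e_\ell\bigr)$ and $Q=(e_{\ell+1}+e_{\ell+3}+\cdots)+(r+1)(e_1+e_3+\cdots)$.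
   Context: Notation: $(q)_n=\prod_{i=1}^n(1-q^i)$, $(q)_\infty=\prod_{i\ge1}(1-q^i)$; all identities are between formal series in (fractional powers of) $q$. $\begin{bmatrix}a+c\\ c\end{bmatrix}=\frac{(q)_{a+c}}{(q)_a(q)_c}$ if $a,c\in\mathbb{Z}_{\ge0}$, and $0$ otherwise. $e_i$ is the $i$-th unit vector in $\mathbb{Z}^N$, $e_i=0$ if $i\notin\{1,\dots,N\}$. $\mathcal I_{T^{(N)}}$ is the $N\times N$ matrix $(\mathcal I_{T^{(N)}})_{i,j}=\delta_{|i-j|,1}+\delta_{i,j}\delta_{i,N}$ and $T^{(N)}=2I-\mathcal I_{T^{(N)}}$. $m\equiv Q\pmod 2$ is meant componentwise. $F^{(p,p')}_{r,s}(L,b)$ is the $M(p,p')$ polynomial, given in bosonic form by $F^{(p,p')}_{r,s}(L,b)=B^{(p,p')}_{r,s}(L,b)$ with $$B^{(p,p')}_{r,s}(L,b)=\sum_{j\in\mathbb{Z}}\left(q^{j(jpp'+rp'-sp)}\begin{bmatrix}L\\ \frac12(L+s-b)-jp'\end{bmatrix}-q^{(jp+r)(jp'+s)}\begin{bmatrix}L\\ \frac12(L-s-b)-jp'\end{bmatrix}\right).$$ Let $C$ be the Cartan matrix of $A_{N-1}$ ($C_{ij}=2\delta_{ij}-\delta_{|i-j|,1}$). The level-$N$ $A_1^{(1)}$ string functions ($m+\ell$ even) are $$c^\ell_m(q)=\frac{q^{\frac{\ell(N-\ell)}{2N(N+2)}}}{(q)_\infty}\sum_{\substack{n\in\mathbb{Z}_{\ge0}^{N-1}\\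 \frac{m+\ell}{2N}+(C^{-1}n)_1\in\mathbb{Z}}}\frac{q^{n^TC^{-1}(n-e_\ell)}}{(q)_{n_1}\cdots(q)_{n_{N-1}}}$$ (here $e_\ell\in\mathbb{Z}^{N-1}$, $e_0=0$; for $N=1$ there is only the empty vector and $(C^{-1}n)_1=0$); they satisfy $c^\ell_m=c^\ell_{-m}=c^\ell_{m+2N}=c^{N-\ell}_{N-m}$. The normalized branching functions of the coset $(P,P')_N$, i.e. $(A^{(1)}_1)_N\times(A_1^{(1)})_{N'}/(A^{(1)}_1)_{N+N'}$ with $N'=NP/(P'-P)-2$, are $$\hat\chi^{(P,P';N)}_{R,S;\ell}(q)=q^{-\frac{\ell(N-\ell)}{2N(N+2)}}\sum_{0\le m\le N/2}c^\ell_{2m}(q)\Biggl(\sum_{\substack{j\in\mathbb{Z}\\ \mu_{R-S}(j)\equiv\pm m\bmod N}}q^{\frac jN(jPP'+P'R-PS)}-\sum_{\substack{j\in\mathbb{Z}\\ \mu_{R+S}(j)\equiv\pm m\bmod N}}q^{\frac1N(jP'+S)(jP+R)}\Biggr),$$ with $R-S\equiv\ell \pmod 2$, $\mu_a(j)=a/2+P'j$, and $m$ running over integers if $\ell$ is even and over half-odd-integers if $\ell$ is odd. *)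

(* Defs.v *)
From HB Require Import structures.
From mathcomp Require Import all_boot all_order all_algebra.
From mathcomp Require Import boolp classical_sets functions cardinality fsbigop.

Set Implicit Arguments.
Unset Strict Implicit.
Unset Printing Implicit Defensive.
Import Order.TTheory GRing.Theory Num.Theory.

Local Open Scope ring_scope.
Local Open Scope classical_set_scope.

Declare Scope qseries_scope.
Delimit Scope qseries_scope with qs.

(* Formal series in fractional powers of q: [f x] is the coefficient of q^x.
   Only coefficientwise finite sums are meaningful; [\sum_(i \in A) F i] is the
   MathComp-Analysis sum over the support of F, which is 0 by convention when
   that support is infinite.  This never happens for the series of this file
   at the parameters of interest: they have support bounded below in (1/D)Z
   for some D > 0, and all infinite families are locally finite because their
   exponents are positive definite quadratic functions of the index. *)
Definition qseries := rat -> int.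

Definition qmono (a : rat) : qseries := fun x => (x == a)%:R.

Notation "''q^(' a ')'" := (qmono a%R)
  (at level 0, a at level 200, format "''q^(' a ')'") : qseries_scope.

(* Cauchy product; not the pointwise product that [rat -> int] also carries. *)
Definition qmul (f g : qseries) : qseries :=
  fun x => \sum_(y \in [set: rat]) f y * g (x - y).

Notation "f ** g" := (qmul f g)
  (at level 40, left associativity) : qseries_scope.

Local Open Scope qseries_scope.

Definition qsum (I : choiceType) (A : set I) (F : I -> qseries) : qseries :=
  fun x => \sum_(i \in A) F i x.

Notation "\qsum_ ( i 'in' A ) F" := (qsum A (fun i => F))
  (at level 41, i at level 0, A at level 60, F at level 41,
   format "'[' \qsum_ ( i  'in'  A ) '/  '  F ']'") : qseries_scope.

(* Inverse of a series whose constant term is 1 and whose other exponents are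
   all >= 1, by the geometric expansion 1/f = \sum_k (1 - f)^k. *)
Definition qinv (f : qseries) : qseries :=
  \qsum_(k in [set: nat]) iter k (qmul ('q^(0) \- f)) 'q^(0).

Definition qpoch (n : nat) : qseries :=
  \big[qmul/'q^(0)]_(1 <= i < n.+1) ('q^(0) \- 'q^(i%:R)).

(* The factors 1 - q^i with i > x do not contribute to the coefficient of q^x. *)
Definition qpoch_infty : qseries := fun x => qpoch (Num.truncn x) x.

(* q-binomial with upper entry t = a + c and lower entry c. *)
Definition qbinom (t c : rat) : qseries :=
  if (t - c \is a Num.nat) && (c \is a Num.nat)
  then qpoch (Num.truncn t)
       ** qinv (qpoch (Num.truncn (t - c)) ** qpoch (Num.truncn c))
  else (fun=> 0).

(* Vectors have entries indexed by 'I_k = {0, ..., k-1}; [unitv] and [coord1]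
   use the indices 1, ..., k, and are 0 outside of that range. *)
Definition unitv (R : pzSemiRingType) (k i : nat) : 'cV[R]_k :=
  \col_(j < k) (j.+1 == i)%:R.
Arguments unitv : clear implicits.

Definition coord1 (R : pzSemiRingType) (k : nat) (v : 'cV[R]_k) (i : nat) : R :=
  \sum_(j < k | j.+1 == i) v j 0.

(* v^T M w as a scalar *)
Definition bilin (k : nat) (v : 'cV[rat]_k) (M : 'M[rat]_k) (w : 'cV[rat]_k) :
  rat := (v^T *m M *m w) 0 0.

Definition ratv (k : nat) (v : 'cV[nat]_k) : 'cV[rat]_k :=
  map_mx (fun n : nat => n%:R) v.

(* Cartan matrix of A_k *)
Definition cartanA (k : nat) : 'M[rat]_k :=
  \matrix_(i, j) ((i == j)%:R * 2 - (`|i%:Z - j%:Z|%N == 1%N)%:R).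

(* Incidence matrix of the tadpole graph, with its loop at the last vertex. *)
Definition incT (N : nat) : 'M[rat]_N :=
  \matrix_(i, j) ((`|i%:Z - j%:Z|%N == 1%N)%:R
                  + ((i == j) && (j.+1 == N))%:R).

Definition cartanT (N : nat) : 'M[rat]_N := 2%:M - incT N.

(* The M(p,p') polynomial F_{r,s}^{(p,p')}(L,b), in its bosonic form. *)
Definition polyF (p p' r s L b : nat) : qseries :=
  let P : rat := p%:R in let P' : rat := p'%:R in
  let R : rat := r%:R in let S : rat := s%:R in
  let l : rat := L%:R in let B : rat := b%:R in
  \qsum_(z in [set: int]) (let j : rat := z%:~R in
    ('q^(j * (j * P * P' + R * P' - S * P)) ** qbinom l ((l + S - B) / 2 - j * P'))
    \- ('q^((j * P + R) * (j * P' + S)) ** qbinom l ((l - S - B) / 2 - j * P'))).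

(* \ell (N - \ell) / (2 N (N + 2)) *)
Definition string_exp (N l : nat) : rat :=
  l%:R * (N%:R - l%:R) / (2 * N%:R * (N%:R + 2)).

(* The level-N A_1^(1) string function c^l_m. *)
Definition string_fun (N l : nat) (m : int) : qseries :=
  let Ci := invmx (cartanA N.-1) in
  'q^(string_exp N l) ** qinv qpoch_infty **
  \qsum_(n in [set n : 'cV[nat]_N.-1 |
                (m + l%:Z)%:~R / (2 * N%:R) + coord1 (Ci *m ratv n) 1
                  \is a Num.int])
    ('q^(bilin (ratv n) Ci (ratv n - unitv rat N.-1 l)) **
     qinv (\big[qmul/'q^(0)]_(i < N.-1) qpoch (n i 0))).

(* a = +m or a = -m modulo N *)
Definition eqpm_mod (N : nat) (a m : rat) : Prop :=
  (a - m) / N%:R \is a Num.int \/ (a + m) / N%:R \is a Num.int.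

(* The normalized branching function \hat\chi^{(P,P';N)}_{R,S;l}.  The outer
   sum is indexed by M = 2m, where 0 <= m <= N/2 and m - l/2 is an integer. *)
Definition branching (P P' N R S l : nat) : qseries :=
  let p : rat := P%:R in let p' : rat := P'%:R in
  let r : rat := R%:R in let s : rat := S%:R in
  let mu (a : rat) (j : int) : rat := a / 2 + p' * j%:~R in
  'q^(- string_exp N l) **
  \qsum_(M in [set M : nat | (M <= N)%N /\ ~~ odd (M + l)])
    (let m : rat := M%:R / 2 in
     string_fun N l M%:Z **
     ((\qsum_(z in [set z : int | eqpm_mod N (mu (r - s) z) m])
         (let j : rat := z%:~R in
          'q^(j / N%:R * (j * p * p' + p' * r - p * s))))
      \- (\qsum_(z in [set z : int | eqpm_mod N (mu (r + s) z) m])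
         (let j : rat := z%:~R in
          'q^(1 / N%:R * ((j * p' + s) * (j * p + r))))))).

(* Q = (e_{l+1} + e_{l+3} + ...) + (r+1) (e_1 + e_3 + ...) *)
Definition parityQ (N l r : nat) : 'cV[nat]_N :=
  \sum_(k < N) unitv nat N (l + 1 + k.*2)%N
  + (\sum_(k < N) unitv nat N (1 + k.*2)%N) *+ r.+1.

(* The vector n solving m + n = (I_T m + e_l) / 2; its entries may be negative
   and the last one may be a half-integer. *)
Definition nvec (N l : nat) (m : 'cV[nat]_N) : 'cV[rat]_N :=
  2^-1 *: (incT N *m ratv m + unitv rat N l) - ratv m.

(* Main.v *)
(* The fermionic sum is a partition function of chains.  For integers x, y let
   P(x, y) be the sum over m_0 = x, m_1, ..., m_(N-1), m_N = y, with the parity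
   of m_0 + m_1 fixed, of
     q^((1/4) sum_j (m_j - m_(j+1))^2)
       prod_(0 < j < N) [ (m_(j-1) + m_(j+1) + delta_(j,l)) / 2 ; m_j ],
   so that the m-sum of the theorem is sum_L P(0, L) F(L, b) / (q)_L.
   The q-Pascal rule, propagated along the chain, gives
     P(x+1, y) + (1 - q^x) P(x-1, y) = P(x, y+1) + (1 - q^y) P(x, y-1),
   the three-term recurrence of continuous q-Hermite polynomials, whence
     P(x, y) = sum_w [x ; w] [y ; w] (q)_w P(0, x + y - 2 w).
   Letting x tend to infinity with y = x + a fixed, the binomials in P(x, y)
   become inverses of Pochhammer symbols and the left-hand side becomes, up to
   a power of q, a string function:
     sum_L P(0, L) / ((q)_((L-a)/2) (q)_((L+a)/2)) = Str(a) / (q)_infty.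
   In F(L, b) / (q)_L each q-binomial is such a kernel, with a = b - s + 2 j p'
   or a = b + s + 2 j p'.  Exchanging the sums over j and L gives the two sums
   of the branching function. *)
Require Import Defs.
From HB Require Import structures.
From mathcomp Require Import all_boot all_order all_algebra.
From mathcomp Require Import boolp classical_sets functions cardinality fsbigop.
From mathcomp Require Import zify ring lra.

Set Implicit Arguments.
Unset Strict Implicit.
Unset Printing Implicit Defensive.
Import Order.TTheory GRing.Theory Num.Theory.

Local Open Scope ring_scope.
Local Open Scope classical_set_scope.
Local Open Scope qseries_scope.

(** Two obstacles shape the proof. An infinite sum of coefficients is silently 0, so each exchange
    of sums must be justified. The work is therefore done in a ring [lser] of left-finite series
    with [summable] families; for chains, summability rests on one estimate: the quadratic energy of
    an integer path bounds the distance it travels. Limits become congruences modulo O(q^E) at an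
    explicit x. The other obstacle is that the limit x -> oo concerns sums over chains, while a
    string function is a sum over n involving an inverse Cartan matrix. The bridge is to write a
    chain as x plus a height path whose second differences are fixed by n. At fixed n the path no
    longer depends on x, each binomial [m_j + n_j; n_j] tends to 1/(q)_(n_j), and the inverse Cartan
    matrix enters as the Green function that recovers a path from its second differences. Dividing
    the linearization formula by (q)_x (q)_y turns its coefficients into 1/((q)_w (q)_(x-w)
    (q)_(y-w)), which is where the kernel in F(L, b) / (q)_L comes from. The kernel is even in a,
    and this yields the symmetry of string functions needed to fold residues. *)

(** * Sums of finite support *)

Section FiniteSupportSums.
Context {M : zmodType}.
Implicit Types I J : choiceType.

Lemma fsumT_sub I (A : set I) (F : I -> M) : finite_set A ->
  (forall i, F i <> 0 -> A i) ->
  \sum_(i \in [set: I]) F i = \sum_(i \in A) F i.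
Proof.
move=> finA FA; apply/esym/fsbig_widen => // i [_ nAi] /=.
by apply: contrapT => /FA.
Qed.

Lemma fsumT_pair I J (F : I -> J -> M) :
  finite_set [set p : I * J | F p.1 p.2 <> 0] ->
  \sum_(p \in [set: I * J]) F p.1 p.2 =
  \sum_(i \in [set: I]) \sum_(j \in [set: J]) F i j.
Proof.
move=> finF; have fin1 := finite_image fst finF.
have fin2 := finite_image snd finF.
rewrite (fsumT_sub (A := _ `*` _) (finite_setX fin1 fin2)); last first.
  by move=> p Fp; split; exists p.
rewrite -pair_fsbig //.
rewrite [RHS](fsumT_sub fin1); last first.
  move=> i Fi; apply: contrapT => ni; apply: Fi; apply: fsbig1 => j _.
  by apply: contrapT => Fij; apply: ni; exists (i, j).
apply: eq_fsbigr => i _; apply/esym/fsumT_sub => // j Fij.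
by exists (i, j).
Qed.

Lemma fsumT_swap I J (F : I -> J -> M) :
  finite_set [set p : I * J | F p.1 p.2 <> 0] ->
  \sum_(i \in [set: I]) \sum_(j \in [set: J]) F i j =
  \sum_(j \in [set: J]) \sum_(i \in [set: I]) F i j.
Proof.
move=> finF; rewrite -fsumT_pair // -(fsumT_pair (F := fun j i => F i j)).
  apply: (reindex_fsbigT (fun p : J * I => (p.2, p.1))).
  by exists (fun p : I * J => (p.2, p.1)) => -[].
apply: sub_finite_set (finite_image (fun p : I * J => (p.2, p.1)) finF).
by move=> -[j i] Fij; exists (i, j).
Qed.

Lemma fsumT_reindex I J (A : set J) (h : J -> I) (F : I -> M) :
  {in A &, injective h} -> (forall i, F i <> 0 -> exists2 j, A j & h j = i) ->
  \sum_(i \in [set: I]) F i =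
  \sum_(j \in [set: J]) (if j \in A then F (h j) else 0).
Proof.
move=> hinj hsurj.
rewrite -(@fsbig_mkcond _ _ _ _ A (fun j => F (h j))).
rewrite -fsbig_image; last exact: hinj.
apply/esym/fsbig_widen => // i [_ ni] /=.
by apply: contrapT => /hsurj [j Aj hj]; apply: ni; exists j.
Qed.

Lemma fsumT_add I (F G : I -> M) :
  finite_set [set i | F i <> 0] -> finite_set [set i | G i <> 0] ->
  \sum_(i \in [set: I]) (F i + G i) =
  \sum_(i \in [set: I]) F i + \sum_(i \in [set: I]) G i.
Proof.
move=> finF finG; have finU : finite_set ([set i | F i <> 0] `|` [set i | G i <> 0]).
  by rewrite finite_setU.
rewrite !(fsumT_sub finU); first by rewrite fsbig_split.
- by right.
- by left.
- move=> i FGi; apply: contrapT => /not_orP[/= /contrapT Fi /contrapT Gi].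
  by apply: FGi; rewrite Fi Gi addr0.
Qed.

Lemma fsumT_opp I (F : I -> M) : finite_set [set i | F i <> 0] ->
  \sum_(i \in [set: I]) - F i = - \sum_(i \in [set: I]) F i.
Proof.
move=> finF; apply/eqP; rewrite -addr_eq0 -fsumT_add //.
  by rewrite fsbig1 // => i _; rewrite addNr.
by apply: sub_finite_set finF => i /= nF Fi; apply: nF; rewrite Fi oppr0.
Qed.

Lemma fsumT1 I (i0 : I) (F : I -> M) : (forall i, i <> i0 -> F i = 0) ->
  \sum_(i \in [set: I]) F i = F i0.
Proof.
move=> F0; rewrite (fsumT_sub (finite_set1 i0)) ?fsbig_set1 // => i Fi.
by apply: contrapT => ni; apply/Fi/F0.
Qed.

End FiniteSupportSums.

(* Left-finite series: finitely many exponents below any bound.  They form a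
   commutative ring for the Cauchy product, unlike all of [qseries]. *)
Definition lfin (f : qseries) : Prop :=
  forall x, finite_set [set y | y < x /\ f y <> 0].

(** This is f = O(q^e). As a record it is not unfolded by unification, while the coercion lets a
    proof be applied to an exponent below e. *)
Record ordge (e : rat) (f : qseries) : Prop :=
  Ordge { ordgeP :> forall y, y < e -> f y = 0 }.

Lemma ordgeW e e' f : e' <= e -> ordge e f -> ordge e' f.
Proof. by move=> le_e fe; split=> y ye; apply: fe; apply: lt_le_trans ye le_e. Qed.

Lemma finite_set_rat_lb (A : set rat) : finite_set A ->
  exists b, forall y, A y -> b <= y.
Proof.
move=> /finite_seqP[s ->]; exists (- \sum_(y <- s) `|y|) => y /= ys.
rewrite lerNl (le_trans (ler_norm (- y))) // normrN (big_rem y ys) /=.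
by rewrite lerDl sumr_ge0.
Qed.

Lemma lfin_ordge f : lfin f -> exists b, ordge b f.
Proof.
move=> ff; have [b bP] := finite_set_rat_lb (ff 0).
exists (Order.min b 0); split=> y; rewrite lt_min => /andP[yb y0].
by apply: contrapT => fy; have := bP y (conj y0 fy); rewrite leNgt yb.
Qed.

(** Both supports are bounded below, so an upper bound on the sum of two exponents bounds each of
    them from above. *)
Lemma qmul_pair_finite f g x : lfin f -> lfin g ->
  finite_set [set p : rat * rat | p.1 + p.2 < x /\ (f p.1 <> 0 /\ g p.2 <> 0)].
Proof.
move=> ff fg; have [a fa] := lfin_ordge ff; have [b gb] := lfin_ordge fg.
apply: sub_finite_set (finite_setX (ff (x - b)) (fg (x - a))).
move=> -[y z] /= [yz [fy gz]].
have ay : a <= y by rewrite leNgt; apply/negP => /fa.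
have bz : b <= z by rewrite leNgt; apply/negP => /gb.
split; split=> //=.
  by rewrite ltrBrDr (le_lt_trans _ yz) // lerD2l.
by rewrite ltrBrDr addrC (le_lt_trans _ yz) // lerD2r.
Qed.

Lemma qmul_finite f g x : lfin f -> lfin g ->
  finite_set [set y | f y * g (x - y) <> 0].
Proof.
move=> ff fg.
apply: sub_finite_set (finite_image fst (qmul_pair_finite (x + 1) ff fg)) => y.
move=> /eqP; rewrite mulf_eq0 negb_or => /andP[/eqP fy /eqP gy].
by exists (y, x - y) => //=; rewrite subrKC ltrDl.
Qed.

Lemma qmul_neq0 f g x : (f ** g) x <> 0 ->
  exists2 y, f y <> 0 & g (x - y) <> 0.
Proof.
apply: contra_notP => nfg; apply: fsbig1 => y _; apply: contrapT => /eqP.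
rewrite mulf_eq0 negb_or => /andP[/eqP fy /eqP gy]; apply: nfg.
by exists y.
Qed.

Lemma ordge_qmul a b f g : ordge a f -> ordge b g -> ordge (a + b) (f ** g).
Proof.
move=> fa gb; split=> x xab; apply: contrapT => /qmul_neq0[y fy gy].
have ay : a <= y by rewrite leNgt; apply/negP => /fa.
have : b <= x - y by rewrite leNgt; apply/negP => /gb.
by rewrite leNgt ltrBlDr addrC (lt_le_trans xab) // lerD2r.
Qed.

Lemma lfin_qmul f g : lfin f -> lfin g -> lfin (f ** g).
Proof.
move=> ff fg x.
apply: sub_finite_set (finite_image (fun p => p.1 + p.2) (qmul_pair_finite x ff fg)).
move=> y [yx /qmul_neq0[z fz gz]]; exists (z, y - z) => //=; last by rewrite subrKC.
by rewrite subrKC.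
Qed.

Lemma qmulC f g : f ** g = g ** f.
Proof.
apply/funext => x; rewrite /qmul (reindex_fsbigT (fun y => x - y)).
  by apply: eq_fsbigr => y _; rewrite subKr mulrC.
by exists (fun y => x - y) => y; rewrite subKr.
Qed.

Lemma qmulE2 f g h x : lfin f -> lfin g -> lfin h ->
  (f ** (g ** h)) x =
  \sum_(p \in [set: rat * rat]) f p.1 * (g p.2 * h (x - p.1 - p.2)).
Proof.
move=> ff fg fh.
rewrite (fsumT_pair (F := fun y z => f y * (g z * h (x - y - z)))).
  by apply: eq_fsbigr => y _; rewrite mulr_fsumr.
have fgh := lfin_qmul fg fh.
have [a fa] := lfin_ordge ff; have [b gb] := lfin_ordge fg.
have [c hc] := lfin_ordge fh.
apply: sub_finite_set (qmul_pair_finite (x - c + 1) ff fg) => -[y z] /= /eqP.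
rewrite !mulf_eq0 !negb_or => /andP[/eqP fy /andP[/eqP gz /eqP hxyz]].
split=> //.
have : c <= x - y - z by rewrite leNgt; apply/negP => /hc.
by rewrite -addrA -opprD lerBrDr -lerBrDl => /le_lt_trans; apply; rewrite ltrDl.
Qed.

Lemma qmulA f g h : lfin f -> lfin g -> lfin h ->
  f ** (g ** h) = (f ** g) ** h.
Proof.
move=> ff fg fh; apply/funext => x.
rewrite (qmulC (f ** g)) (qmulC f g) !qmulE2 //.
(* With the right side rewritten as h (g f), both sides are sums over two of three exponents of
   total x; the involution exchanges the exponents of f and h. *)
rewrite [LHS](reindex_fsbigT (fun p => (x - p.1 - p.2, p.2))).
  apply: eq_fsbigr => -[y z] _ /=.
  rewrite [RHS]mulrC -mulrA mulrCA; congr (_ * (_ * h _)); ring.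
by exists (fun p => (x - p.1 - p.2, p.2)) => -[y z] /=; congr pair; ring.
Qed.

Lemma lfin_add f g : lfin f -> lfin g -> lfin (f \+ g).
Proof.
move=> ff fg x; have finU : finite_set ([set y | y < x /\ f y <> 0] `|`
    [set y | y < x /\ g y <> 0]) by rewrite finite_setU.
apply: sub_finite_set finU => y [yx fgy].
apply: contrapT => /not_orP[/= /not_andP[//|/contrapT fy] /not_andP[//|/contrapT gy]].
by apply: fgy; rewrite /= fy gy.
Qed.

Lemma lfin_opp f : lfin f -> lfin (\- f).
Proof.
move=> ff x; apply: sub_finite_set (ff x) => y [yx fy]; split => // fy0.
by apply: fy; rewrite /= fy0.
Qed.

Lemma lfin0 : lfin (fun=> 0).
Proof. by move=> x; apply: sub_finite_set (finite_set0 rat) => y []. Qed.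

Lemma lfin_qmono a : lfin 'q^(a).
Proof.
move=> x; apply: sub_finite_set (finite_set1 a) => y [_ /=].
by rewrite /qmono; case: eqP.
Qed.

Lemma qmul_monol a f x : ('q^(a) ** f) x = f (x - a).
Proof.
rewrite /qmul (fsumT1 (i0 := a)) /qmono ?eqxx ?mul1r // => y /eqP/negPf->.
by rewrite mul0r.
Qed.

Lemma qmul_addl f g h : lfin f -> lfin g -> lfin h ->
  (f \+ g) ** h = (f ** h) \+ (g ** h).
Proof.
move=> ff fg fh; apply/funext => x /=; rewrite /qmul -fsumT_add.
- by apply: eq_fsbigr => y _; rewrite mulrDl.
- exact: qmul_finite.
- exact: qmul_finite.
Qed.

(** * The commutative ring of left-finite series *)

Record lser := Lser { lval :> rat -> int; lvalP : lfin lval }.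

Lemma lser_eq (f g : lser) : (forall x, f x = g x) -> f = g.
Proof.
case: f g => [f ff] [g fg] /= /funext efg; rewrite -efg in fg *.
by congr Lser; apply: Prop_irrelevance.
Qed.

HB.instance Definition _ := gen_eqMixin lser.
HB.instance Definition _ := gen_choiceMixin lser.

Definition lzero : lser := Lser lfin0.
Definition lopp (f : lser) : lser := Lser (lfin_opp (lvalP f)).
Definition ladd (f g : lser) : lser := Lser (lfin_add (lvalP f) (lvalP g)).
Definition lmul (f g : lser) : lser := Lser (lfin_qmul (lvalP f) (lvalP g)).
Definition lq (a : rat) : lser := Lser (lfin_qmono a).

Lemma laddA : associative ladd.
Proof. by move=> f g h; apply: lser_eq => x /=; rewrite addrA. Qed.
Lemma laddC : commutative ladd.
Proof. by move=> f g; apply: lser_eq => x /=; rewrite addrC. Qed.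
Lemma ladd0 : left_id lzero ladd.
Proof. by move=> f; apply: lser_eq => x /=; rewrite add0r. Qed.
Lemma laddN : left_inverse lzero lopp ladd.
Proof. by move=> f; apply: lser_eq => x /=; rewrite addNr. Qed.

HB.instance Definition _ := GRing.isZmodule.Build lser laddA laddC ladd0 laddN.

Lemma lmulA : associative lmul.
Proof.
move=> f g h; apply: lser_eq => x; rewrite /= qmulA //; exact: lvalP.
Qed.
Lemma lmulC : commutative lmul.
Proof. by move=> f g; apply: lser_eq => x; rewrite /= qmulC. Qed.
Lemma lmul1 : left_id (lq 0) lmul.
Proof. by move=> f; apply: lser_eq => x; rewrite /= qmul_monol subr0. Qed.
Lemma lmulDl : left_distributive lmul +%R.
Proof.
by move=> f g h; apply: lser_eq => x; rewrite /= qmul_addl //; exact: lvalP.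
Qed.
Lemma lone_neq0 : lq 0 != 0.
Proof. by apply/eqP => /(congr1 (fun f : lser => f 0)); rewrite /= /qmono eqxx. Qed.

HB.instance Definition _ := GRing.Zmodule_isComNzRing.Build lser
  lmulA lmulC lmul1 lmulDl lone_neq0.

Lemma laddE (f g : lser) x : (f + g) x = f x + g x. Proof. by []. Qed.
Lemma loppE (f : lser) x : (- f) x = - f x. Proof. by []. Qed.
Lemma lmulE (f g : lser) : (f * g : lser) = f ** g :> qseries. Proof. by []. Qed.
Lemma lqE a : lq a = 'q^(a) :> qseries. Proof. by []. Qed.
Lemma lq0 : lq 0 = 1. Proof. by []. Qed.

Lemma lqD a b : lq (a + b) = lq a * lq b.
Proof.
apply: lser_eq => x; rewrite lmulE qmul_monol /= /qmono.
by rewrite subr_eq addrC.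
Qed.

Lemma lprodE (I : Type) (r : seq I) (P : pred I) (F : I -> lser) :
  (\prod_(i <- r | P i) F i : lser) =
  \big[qmul/'q^(0)]_(i <- r | P i) (F i : qseries) :> qseries.
Proof. exact: (big_morph lval (fun f g => erefl) erefl). Qed.

Lemma ordge0 e : ordge e (0 : lser). Proof. by split. Qed.

Lemma ordgeD e (f g : lser) : ordge e f -> ordge e g -> ordge e (f + g).
Proof. by move=> fe ge; split=> y ye; rewrite laddE (fe _ ye) (ge _ ye). Qed.

Lemma ordgeN e (f : lser) : ordge e f -> ordge e (- f).
Proof. by move=> fe; split=> y ye; rewrite loppE (fe _ ye) oppr0. Qed.

Lemma ordgeB e (f g : lser) : ordge e f -> ordge e g -> ordge e (f - g).
Proof. by move=> fe ge; apply/ordgeD/ordgeN. Qed.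

Lemma ordge_lq a : ordge a (lq a).
Proof. by split=> y; rewrite /= /qmono lt_neqAle => /andP[/negPf-> _]. Qed.

Lemma ordge1 : ordge 0 (1 : lser). Proof. exact: ordge_lq. Qed.

Lemma ordgeM a b (f g : lser) : ordge a f -> ordge b g -> ordge (a + b) (f * g).
Proof. exact: ordge_qmul. Qed.

Lemma ordgeM0 (f g : lser) : ordge 0 f -> ordge 0 g -> ordge 0 (f * g).
Proof. by move=> f0 g0; have := ordgeM f0 g0; rewrite addr0. Qed.

Lemma ordgeMl a (f g : lser) : ordge a f -> ordge 0 g -> ordge a (f * g).
Proof. by move=> f0 g0; have := ordgeM f0 g0; rewrite addr0. Qed.

Lemma ordgeMr a (f g : lser) : ordge 0 f -> ordge a g -> ordge a (f * g).
Proof. by move=> f0 g0; have := ordgeM f0 g0; rewrite add0r. Qed.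

Lemma ordge_prod (I : Type) (r : seq I) (P : pred I) (F : I -> lser) :
  (forall i, P i -> ordge 0 (F i)) -> ordge 0 (\prod_(i <- r | P i) F i : lser).
Proof.
move=> F0; elim/big_rec: _ => [|i f Pi f0]; first exact: ordge1.
by apply: ordgeM0 => //; apply: F0.
Qed.

(** The q-adic filtration is separated; limits are therefore expressed by agreement modulo every
    O(q^e). *)
Lemma lser_eq_ord (f g : lser) : (forall e, ordge e (f - g)) -> f = g.
Proof.
move=> fg; apply: lser_eq => x; have /ordgeP/(_ x) := fg (x + 1).
by rewrite ltrDl ltr01 laddE loppE => /(_ isT)/subr0_eq.
Qed.

Lemma finite_preimage_in T U (A : set T) (B : set U) (h : T -> U) :
  {in A &, injective h} -> finite_set B -> finite_set (A `&` h @^-1` B).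
Proof.
move=> hinj finB.
have -> : A `&` h @^-1` B = \bigcup_(u in B) (A `&` h @^-1` [set u]).
  apply/seteqP; split=> [j [Aj Bj]|j [u Bu [Aj hj]]]; first by exists (h j).
  by split=> //=; rewrite hj.
apply: bigcup_finite => // u _.
have [[j [Aj hj]]|nex] := pselect (exists j, A j /\ h j = u).
  apply: sub_finite_set (finite_set1 j) => k [Ak hk].
  by apply: hinj; rewrite ?in_setE // hj.
apply: sub_finite_set (finite_set0 T) => k [Ak hk].
by apply: nex; exists k.
Qed.

(** * Summable families *)

Section Summable.
Implicit Types I J : choiceType.

(** Unconditional q-adic convergence: every coefficient of the sum is a finite sum, so the default
    value 0 of infinite sums never interferes. *)
Definition summable I (F : I -> lser) : Prop :=
  forall e, finite_set [set i | ~ ordge e (F i)].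

Lemma summable_finite I (F : I -> lser) x : summable F ->
  finite_set [set i | F i x <> 0].
Proof.
move=> sF; apply: sub_finite_set (sF (x + 1)) => i Fi /ordgeP/(_ x).
by rewrite ltrDl => /(_ isT).
Qed.

Lemma lfin_lsum I (F : I -> lser) : summable F ->
  lfin (fun x => \sum_(i \in [set: I]) F i x).
Proof.
move=> sF x; have finU : finite_set
    (\bigcup_(i in [set i | ~ ordge x (F i)]) [set y | y < x /\ F i y <> 0]).
  by apply: bigcup_finite => // i _; exact: lvalP.
apply: sub_finite_set finU => y [yx Fy]; apply: contrapT => nU; apply: Fy.
apply: fsbig1 => i _; apply: contrapT => Fiy; apply: nU; exists i => //= -[xi].
by apply: Fiy; apply: xi.
Qed.

Definition lsum I (F : I -> lser) : lser :=
  if pselect (summable F) is left sF then Lser (lfin_lsum sF) else 0.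

Lemma lsumE I (F : I -> lser) x : summable F ->
  lsum F x = \sum_(i \in [set: I]) F i x.
Proof. by rewrite /lsum; case: pselect. Qed.

Lemma eq_lsum I (F G : I -> lser) : F =1 G -> lsum F = lsum G.
Proof. by move=> /funext ->. Qed.

Lemma qsumE I (A : set I) (F : I -> lser) :
  summable (fun i => if i \in A then F i else 0) ->
  qsum A (fun i => F i : qseries) =
  lsum (fun i => if i \in A then F i else 0) :> qseries.
Proof.
move=> sF; apply/funext => x; rewrite lsumE // /qsum fsbig_mkcond.
by apply: eq_fsbigr => i _; rewrite /patch; case: ifP.
Qed.

Lemma summable_dom I (F G : I -> lser) :
  (forall i e, ordge e (F i) -> ordge e (G i)) -> summable F -> summable G.
Proof.
by move=> FG sF e; apply: sub_finite_set (sF e) => i; apply: contra_not => /FG.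
Qed.

Lemma summable_ge I (w : I -> rat) (F : I -> lser) :
  (forall e, finite_set [set i | w i < e]) -> (forall i, ordge (w i) (F i)) ->
  summable F.
Proof.
move=> finw Fw e; apply: sub_finite_set (finw e) => i /=.
by apply: contra_notP => /negP; rewrite -leNgt => ei; apply: ordgeW ei (Fw i).
Qed.

Lemma summable_supp I (F : I -> lser) (A : set I) : finite_set A ->
  (forall i, F i <> 0 -> A i) -> summable F.
Proof.
move=> finA FA e; apply: sub_finite_set finA => i ei; apply: FA => Fi.
by apply: ei; rewrite Fi; exact: ordge0.
Qed.

Lemma summableD I (F G : I -> lser) : summable F -> summable G ->
  summable (fun i => F i + G i).
Proof.
move=> sF sG e.
have finU : finite_set ([set i | ~ ordge e (F i)] `|` [set i | ~ ordge e (G i)]).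
  by rewrite finite_setU; split; [exact: sF|exact: sG].
apply: sub_finite_set finU => i; apply: contra_notP.
by move=> /not_orP[/= /contrapT Fi /contrapT Gi]; apply: ordgeD.
Qed.

Lemma summableN I (F : I -> lser) : summable F -> summable (fun i => - F i).
Proof. by apply: summable_dom => i e; exact: ordgeN. Qed.

Lemma summableB I (F G : I -> lser) : summable F -> summable G ->
  summable (fun i => F i - G i).
Proof. by move=> sF sG; apply/summableD/summableN. Qed.

Lemma summableMl I (c : lser) (F : I -> lser) : summable F ->
  summable (fun i => c * F i).
Proof.
move=> sF e; have [b cb] := lfin_ordge (lvalP c).
apply: sub_finite_set (sF (e - b)) => i; apply: contra_not => Fi.
by rewrite -(subrKC b e); apply: ordgeM.
Qed.

Lemma summable_comp I J (h : J -> I) (F : I -> lser) : injective h ->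
  summable F -> summable (fun j => F (h j)).
Proof.
move=> hinj sF e.
have -> : [set j | ~ ordge e (F (h j))] = h @^-1` [set i | ~ ordge e (F i)] by [].
apply: finite_preimage (sF e) => x y _ _; exact: hinj.
Qed.

Lemma summable_if I (A : set I) (F : I -> lser) : summable F ->
  summable (fun i => if i \in A then F i else 0).
Proof. by apply: summable_dom => i e; case: ifP => // _ _; exact: ordge0. Qed.

Lemma lsumD I (F G : I -> lser) : summable F -> summable G ->
  lsum (fun i => F i + G i) = lsum F + lsum G.
Proof.
move=> sF sG; apply: lser_eq => x; rewrite laddE !lsumE //; last exact: summableD.
by rewrite -fsumT_add //; exact: summable_finite.
Qed.

Lemma lsumN I (F : I -> lser) : summable F -> lsum (fun i => - F i) = - lsum F.
Proof.
move=> sF; apply: lser_eq => x; rewrite loppE !lsumE //; last exact: summableN.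
by rewrite -fsumT_opp //; exact: summable_finite.
Qed.

Lemma lsumB I (F G : I -> lser) : summable F -> summable G ->
  lsum (fun i => F i - G i) = lsum F - lsum G.
Proof. by move=> sF sG; rewrite lsumD ?lsumN //; exact: summableN. Qed.

(** If c has order at least b, an index i with F i of order at least x - b + 1 contributes nothing
    to the coefficient of q^x; only finitely many indices remain. *)
Lemma summable_mul_pair I (c : lser) (F : I -> lser) x : summable F ->
  finite_set [set p : rat * I | c p.1 * F p.2 (x - p.1) <> 0].
Proof.
move=> sF; have [b cb] := lfin_ordge (lvalP c).
set A := [set i | ~ ordge (x - b + 1) (F i)].
have finU : finite_set (\bigcup_(i in A)
    [set p : rat * I | p.2 = i /\ c p.1 * F i (x - p.1) <> 0]).
  apply: bigcup_finite => [|i _]; first exact: sF.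
  apply: sub_finite_set (finite_image (fun y => (y, i))
    (qmul_finite x (lvalP c) (lvalP (F i)))).
  by move=> [y _] [/= -> yi]; exists y.
apply: sub_finite_set finU => -[y i] /= yi; exists i => // Fi.
apply: yi; have [yb|yb] := ltP y b; first by rewrite (cb _ yb) mul0r.
by rewrite (ordgeP Fi) ?mulr0 //; lra.
Qed.

Lemma lsumMl I (c : lser) (F : I -> lser) : summable F ->
  lsum (fun i => c * F i) = c * lsum F.
Proof.
move=> sF; apply: lser_eq => x; rewrite lsumE; last exact: summableMl.
rewrite lmulE /qmul.
transitivity (\sum_(y \in [set: rat]) \sum_(i \in [set: I]) c y * F i (x - y)).
  apply/esym/(fsumT_swap (F := fun y i => c y * F i (x - y))).
  exact: summable_mul_pair.
by apply: eq_fsbigr => y _; rewrite lsumE // mulr_fsumr.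
Qed.

Lemma ordge_lsum I (F : I -> lser) e : (forall i, ordge e (F i)) ->
  ordge e (lsum F).
Proof.
(* A family that is not summable has sum 0 by convention, which has every order. *)
move=> Fe; rewrite /lsum; case: pselect => [sF|_]; last exact: ordge0.
by split=> x xe /=; apply: fsbig1 => i _; apply: Fe.
Qed.

Lemma summable_pair1 I J (F : I * J -> lser) i : summable F ->
  summable (fun j => F (i, j)).
Proof. by apply: (summable_comp (h := fun j => (i, j))) => j j' []. Qed.

Lemma summable_lsum I J (F : I -> J -> lser) :
  summable (fun p : I * J => F p.1 p.2) ->
  summable (fun i => lsum (F i)).
Proof.
move=> sF e; apply: sub_finite_set (finite_image fst (sF e)) => i.
apply: contra_notP => ni; apply: ordge_lsum => j.
by apply: contrapT => Fij; apply: ni; exists (i, j).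
Qed.

Lemma lsum_pair I J (F : I -> J -> lser) :
  summable (fun p : I * J => F p.1 p.2) ->
  lsum (fun p : I * J => F p.1 p.2) = lsum (fun i => lsum (F i)).
Proof.
move=> sF; apply: lser_eq => x; rewrite !lsumE //; last exact: summable_lsum.
rewrite (fsumT_pair (F := fun i j => F i j x)); last exact: (summable_finite x sF).
apply: eq_fsbigr => i _; rewrite lsumE //.
exact: (summable_pair1 (F := fun p => F p.1 p.2)).
Qed.

Lemma summable_pairC I J (F : I -> J -> lser) :
  summable (fun p : I * J => F p.1 p.2) ->
  summable (fun p : J * I => F p.2 p.1).
Proof. by apply: (summable_comp (h := fun p => (p.2, p.1))) => -[? ?] [? ?] [-> ->]. Qed.

Lemma lsum_swap I J (F : I -> J -> lser) :
  summable (fun p : I * J => F p.1 p.2) ->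
  lsum (fun i => lsum (F i)) = lsum (fun j => lsum (F^~ j)).
Proof.
move=> sF; have sF' := summable_pairC sF.
apply: lser_eq => x; rewrite !lsumE; last exact: summable_lsum; last first.
  exact: (summable_lsum (F := fun j i => F i j)).
transitivity (\sum_(i \in [set: I]) \sum_(j \in [set: J]) F i j x).
  apply: eq_fsbigr => i _; rewrite lsumE //.
  exact: (summable_pair1 (F := fun p => F p.1 p.2)).
rewrite (fsumT_swap (F := fun i j => F i j x)); last exact: (summable_finite x sF).
apply: eq_fsbigr => j _; rewrite lsumE //.
exact: (summable_pair1 (F := fun p => F p.2 p.1)).
Qed.

Lemma lsum_reindex I J (A : set J) (h : J -> I) (F : I -> lser) :
  summable F -> {in A &, injective h} ->
  (forall i, F i <> 0 -> exists2 j, A j & h j = i) ->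
  lsum F = lsum (fun j => if j \in A then F (h j) else 0).
Proof.
move=> sF hinj hsurj.
have sG : summable (fun j => if j \in A then F (h j) else 0).
  move=> e; apply: sub_finite_set (finite_preimage_in hinj (sF e)) => j /=.
  by case: ifPn => [|_ n0]; [rewrite in_setE|case: n0].
apply: lser_eq => x; rewrite !lsumE // (fsumT_reindex hinj).
  by apply: eq_fsbigr => j _; case: ifP.
move=> i Fi; apply: hsurj => Fi0; apply: Fi; by rewrite Fi0.
Qed.
Lemma summable_reindex I J (A : set J) (h : J -> I) (F : I -> lser) :
  summable F -> {in A &, injective h} ->
  summable (fun j => if j \in A then F (h j) else 0).
Proof.
move=> sF hinj e; apply: sub_finite_set (finite_preimage_in hinj (sF e)) => j /=.
by case: ifPn => [|_ n0]; [rewrite in_setE|case: n0].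
Qed.

Lemma lsum_reindex_bij I J (h : J -> I) (F : I -> lser) : summable F ->
  bijective h -> lsum F = lsum (fun j => F (h j)).
Proof.
move=> sF hbij; rewrite (lsum_reindex (A := [set: J]) (h := h)) //.
- by apply: eq_lsum => j; rewrite in_setT.
- by move=> j j' _ _; apply: bij_inj.
- by case: hbij => g hg gh i _; exists (g i).
Qed.

Lemma lsum1 I (i0 : I) (F : I -> lser) : (forall i, i <> i0 -> F i = 0) ->
  lsum F = F i0.
Proof.
move=> F0; have sF : summable F.
  by apply: (summable_supp (finite_set1 i0)) => i; apply: contra_notP => /F0.
by apply: lser_eq => x; rewrite lsumE // (fsumT1 (i0 := i0)) // => i /F0->.
Qed.

Lemma lsum0 I : lsum (fun _ : I => 0) = 0.
Proof.
have s0 : summable (fun _ : I => (0 : lser)).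
  by apply: (summable_supp (finite_set0 I)) => i [].
by apply: lser_eq => x; rewrite lsumE // fsbig1.
Qed.

Lemma lsum_ord n (F : nat -> lser) : (forall k, (n <= k)%N -> F k = 0) ->
  lsum F = \sum_(k < n) F k.
Proof.
move=> F0; have sF : summable F.
  apply: (summable_supp (finite_II n)) => k /=; apply: contra_notT.
  by rewrite -leqNgt => /F0.
have sumE (m : nat) x : (\sum_(k < m) F k : lser) x = \sum_(k < m) F k x.
  exact: (big_morph (fun f : lser => f x) (fun f g => laddE f g x) erefl).
apply: lser_eq => x; rewrite lsumE // sumE.
rewrite (@fsbig_ord _ _ _ n (fun k => F k x)).
apply: fsumT_sub => [|k Fk /=]; first exact: finite_II.
by rewrite ltnNge; apply/negP => /F0 Fk0; apply: Fk; rewrite Fk0.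
Qed.

Lemma lsum_recl (F : nat -> lser) : summable F ->
  lsum F = F 0%N + lsum (fun n => F n.+1).
Proof.
move=> sF; have sS : summable (fun n => F n.+1).
  by apply: (summable_comp (h := succn)) sF => m n [].
pose G n := if n is m.+1 then F m.+1 else 0.
have sG : summable G by apply: summable_dom sF => -[|n] e //= _; exact: ordge0.
have -> : lsum (fun n => F n.+1) = lsum G.
  rewrite (lsum_reindex (A := [set: nat]) (h := succn) sG).
  - by apply: eq_lsum => n; rewrite in_setT.
  - by move=> m n _ _ [].
  - by move=> [|n] //= _; exists n.
pose F0 n := if n is m.+1 then 0 else F 0%N.
have sF0 : summable F0 by apply: summable_dom sF => -[|n] e //= _; exact: ordge0.
have <- : lsum F0 = F 0%N by rewrite (lsum1 (i0 := 0%N)) // => -[].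
by rewrite -lsumD //; apply: eq_lsum => -[|n] /=; rewrite ?addr0 ?add0r.
Qed.

End Summable.

(** * Geometric series and inverses *)

Lemma finite_nat_lt (e : rat) : finite_set [set n : nat | n%:R < e].
Proof.
have [e0|e0] := leP e 0.
  apply: sub_finite_set (finite_set0 nat) => n /= ne.
  by have := lt_le_trans ne e0; rewrite ltNge ler0n.
apply: sub_finite_set (finite_II (Num.truncn e).+1) => n /= ne.
by rewrite -(ltr_nat rat) (lt_trans ne) // truncnS_gt.
Qed.

Section Geometric.
Variable g : lser.
Hypothesis g1 : ordge 1 g.

Lemma ordge_exp n : ordge n%:R (g ^+ n).
Proof.
elim: n => [|n IH]; first exact: ordge1.
by rewrite exprSr -natr1; apply: ordgeM.
Qed.

Lemma summable_exp : summable (fun n => g ^+ n).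
Proof. exact: summable_ge finite_nat_lt ordge_exp. Qed.

Lemma lsum_exp : (1 - g) * lsum (fun n => g ^+ n) = 1.
Proof.
rewrite mulrBl mul1r -lsumMl; last exact: summable_exp.
rewrite lsum_recl; last exact: summable_exp.
have -> : lsum (fun n => g ^+ n.+1) = lsum (fun n => g * g ^+ n).
  by apply: eq_lsum => n; rewrite exprS.
by rewrite expr0 addrK.
Qed.

End Geometric.


(** Inverses in a commutative ring are unique, so any known inverse of f can replace the geometric
    expansion that defines [qinv]. *)
Lemma qinvE (f h : lser) : ordge 1 (1 - f) -> f * h = 1 -> qinv f = h.
Proof.
move=> f1 fh; set g := 1 - f in f1 *.
have iterE n : iter n (qmul ('q^(0) \- f)) 'q^(0) = g ^+ n.
  elim: n => [//|n IH]; rewrite iterS IH exprS lmulE; congr qmul.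
have sg : summable (fun n => if n \in [set: nat] then g ^+ n else 0).
  exact/summable_if/summable_exp.
rewrite /qinv; have -> : (fun k => iter k (qmul ('q^(0) \- f)) 'q^(0)) =
    (fun k => g ^+ k : qseries) by apply/funext.
rewrite qsumE //; congr lval.
have -> : lsum (fun n => if n \in [set: nat] then g ^+ n else 0) =
    lsum (fun n => g ^+ n) by apply: eq_lsum => n; rewrite in_setT.
by rewrite -[LHS]mul1r -fh mulrAC -[f](subKr 1) -/g lsum_exp // mul1r.
Qed.

Definition linv (f : lser) : lser := lsum (fun k => (1 - f) ^+ k).

Lemma mul_linv (f : lser) : ordge 1 (1 - f) -> f * linv f = 1.
Proof. by move=> f1; rewrite -{1}[f](subKr 1); apply: lsum_exp. Qed.

Lemma qinv_linv (f : lser) : ordge 1 (1 - f) -> qinv f = linv f.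
Proof. by move=> f1; apply/qinvE/mul_linv. Qed.

Lemma ordge_linv (f : lser) : ordge 1 (1 - f) -> ordge 0 (linv f).
Proof.
move=> f1; apply: ordge_lsum => k.
by apply: ordgeW _ (ordge_exp f1 k); rewrite ler0n.
Qed.

Lemma ordge_1subM e (f g : lser) : 0 <= e -> ordge e (1 - f) -> ordge e (1 - g) ->
  ordge e (1 - f * g).
Proof.
move=> e0 fe ge; have -> : 1 - f * g = (1 - f) + f * (1 - g) by ring.
apply: ordgeD => //; apply: ordgeMr => //; rewrite -[f](subKr 1).
by apply: ordgeB; [exact: ordge1|exact: ordgeW fe].
Qed.

(** * Pochhammer symbols and q-binomials *)

Definition lpoch (n : nat) : lser := \prod_(1 <= i < n.+1) (1 - lq i%:R).

Lemma qpochE n : qpoch n = lpoch n.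
Proof. by rewrite /lpoch lprodE. Qed.

Lemma lpoch0 : lpoch 0 = 1. Proof. by rewrite /lpoch big_geq. Qed.

Lemma lpochS n : lpoch n.+1 = lpoch n * (1 - lq n.+1%:R).
Proof. by rewrite /lpoch big_nat_recr. Qed.

Lemma ordge_1sub_lpoch n : ordge 1 (1 - lpoch n).
Proof.
elim: n => [|n IH]; first by rewrite lpoch0 subrr; exact: ordge0.
rewrite lpochS; apply: ordge_1subM => //; rewrite subKr.
by apply: ordgeW _ (ordge_lq _); rewrite ler1n.
Qed.

Lemma ordge_lpoch n : ordge 0 (lpoch n).
Proof.
rewrite -[lpoch n](subKr 1); apply: ordgeB; first exact: ordge1.
by apply: ordgeW _ (ordge_1sub_lpoch n).
Qed.

Definition hpoch (n : nat) : lser := linv (lpoch n).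

Lemma mul_hpoch n : lpoch n * hpoch n = 1.
Proof. exact/mul_linv/ordge_1sub_lpoch. Qed.

Lemma hpoch0 : hpoch 0 = 1.
Proof. by have := mul_hpoch 0; rewrite lpoch0 mul1r. Qed.

Lemma hpochS n : hpoch n = (1 - lq n.+1%:R) * hpoch n.+1.
Proof.
have := mul_hpoch n.+1; rewrite lpochS => h.
transitivity (hpoch n * (lpoch n * (1 - lq n.+1%:R) * hpoch n.+1)).
  by rewrite h mulr1.
by rewrite !mulrA [hpoch n * _]mulrC mul_hpoch mul1r.
Qed.

Lemma ordge_hpoch n : ordge 0 (hpoch n).
Proof. exact/ordge_linv/ordge_1sub_lpoch. Qed.

Lemma lpoch_stable m n : ordge m.+1%:R (lpoch (m + n) - lpoch m).
Proof.
elim: n => [|n IH]; first by rewrite addn0 subrr; exact: ordge0.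
rewrite addnS lpochS mulrBr mulr1 addrAC; apply: ordgeB => //.
apply: ordgeMr; first exact: ordge_lpoch.
by apply: ordgeW _ (ordge_lq _); rewrite ler_nat ltnS leq_addr.
Qed.

(** Below exponent x the coefficients are those of the single product [lpoch (truncn x)], by
    [lpoch_stable]. *)
Lemma lfin_qpoch_infty : lfin qpoch_infty.
Proof.
move=> x; apply: sub_finite_set (lvalP (lpoch (Num.truncn x)) x) => y.
move=> -[yx py]; split=> //; move: py; rewrite /qpoch_infty qpochE.
have le_xy : (Num.truncn y <= Num.truncn x)%N by apply/le_truncn/ltW.
have /ordgeP/(_ y) := @lpoch_stable (Num.truncn y) (Num.truncn x - Num.truncn y).
by rewrite truncnS_gt subnKC // => /(_ isT); rewrite laddE loppE => /subr0_eq->.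
Qed.

Definition lpoch_infty : lser := Lser lfin_qpoch_infty.

Lemma lpoch_infty_stable n : ordge n.+1%:R (lpoch_infty - lpoch n).
Proof.
split=> y yn; rewrite laddE loppE /= /qpoch_infty qpochE.
have le_yn : (Num.truncn y <= n)%N by rewrite truncn_le_nat.
have /ordgeP/(_ y) := @lpoch_stable (Num.truncn y) (n - Num.truncn y).
rewrite truncnS_gt subnKC // => /(_ isT); rewrite laddE loppE => /subr0_eq->.
by rewrite subrr.
Qed.

Lemma ordge_1sub_lpoch_infty : ordge 1 (1 - lpoch_infty).
Proof.
rewrite -opprB; apply: ordgeN; rewrite -lpoch0.
exact: (lpoch_infty_stable 0).
Qed.

Definition hpoch_infty : lser := linv lpoch_infty.

Lemma mul_hpoch_infty : lpoch_infty * hpoch_infty = 1.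
Proof. exact/mul_linv/ordge_1sub_lpoch_infty. Qed.

Lemma ordge_hpoch_infty : ordge 0 hpoch_infty.
Proof. exact/ordge_linv/ordge_1sub_lpoch_infty. Qed.

Lemma hpoch_stable n : ordge n.+1%:R (hpoch n - hpoch_infty).
Proof.
have -> : hpoch n - hpoch_infty =
    hpoch n * hpoch_infty * (lpoch_infty - lpoch n).
  rewrite mulrBr -mulrA [hpoch_infty * _]mulrC mul_hpoch_infty mulr1.
  by rewrite mulrAC [hpoch n * _]mulrC mul_hpoch mul1r.
apply/ordgeMr/lpoch_infty_stable.
by apply: ordgeM0; [exact: ordge_hpoch|exact: ordge_hpoch_infty].
Qed.

Definition gbin (K m : nat) : lser :=
  if (m <= K)%N then lpoch K * hpoch m * hpoch (K - m) else 0.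

Lemma ordge_gbin K m : ordge 0 (gbin K m).
Proof.
rewrite /gbin; case: ifP => _; last exact: ordge0.
apply/ordgeM0/ordge_hpoch/ordgeM0/ordge_hpoch/ordge_lpoch.
Qed.

Lemma gbin0 K : gbin K 0 = 1.
Proof. by rewrite /gbin /= hpoch0 mulr1 subn0 mul_hpoch. Qed.

Lemma gbin_gt K m : (K < m)%N -> gbin K m = 0.
Proof. by rewrite /gbin ltnNge => /negPf->. Qed.

Lemma gbinnn K : gbin K K = 1.
Proof. by rewrite /gbin leqnn subnn hpoch0 mulr1 mul_hpoch. Qed.

Lemma gbinS K m : gbin K.+1 m.+1 = gbin K m + lq m.+1%:R * gbin K m.+1.
Proof.
case: (ltngtP m K) => [lt_mK|lt_Km|->]; last first.
- by rewrite !gbinnn gbin_gt // mulr0 addr0.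
- by rewrite !gbin_gt ?mulr0 ?addr0 // ltnW.
rewrite /gbin ltnS (ltnW lt_mK) lt_mK subSS lpochS.
rewrite (hpochS m) (hpochS (K - m.+1)) -subSn // subSS.
have -> : lq K.+1%:R = lq m.+1%:R * lq (K - m)%:R.
  by rewrite -lqD -natrD addSn subnKC // ltnW.
ring.
Qed.

Lemma gbin_mulS K m : (1 - lq K.+1%:R) * gbin K m = (1 - lq m.+1%:R) * gbin K.+1 m.+1.
Proof.
rewrite /gbin ltnS; case: ifP => _; last by rewrite !mulr0.
by rewrite lpochS subSS (hpochS m); ring.
Qed.

Lemma gbin_stable m n : ordge m.+1%:R (gbin (m + n) n - hpoch n).
Proof.
rewrite /gbin leq_addl addnK.
have -> : lpoch (m + n) * hpoch n * hpoch m - hpoch n =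
    hpoch n * hpoch m * (lpoch (m + n) - lpoch m).
  transitivity (lpoch (m + n) * hpoch n * hpoch m -
    lpoch m * hpoch m * hpoch n); last by ring.
  by rewrite mul_hpoch mul1r.
apply/ordgeMr/lpoch_stable.
by apply: ordgeM0; exact: ordge_hpoch.
Qed.

Lemma gbin_sym m n : gbin (m + n) m = gbin (m + n) n.
Proof. by rewrite /gbin leq_addr leq_addl addKn addnK -!mulrA [hpoch m * _]mulrC. Qed.

Lemma gbin_fact m n : gbin (m + n) m = lpoch (m + n) * hpoch m * hpoch n.
Proof. by rewrite /gbin leq_addr addKn. Qed.

Lemma qbinomE (t c : rat) :
  qbinom t c = (if (t - c \is a Num.nat) && (c \is a Num.nat)
                then gbin (Num.truncn t) (Num.truncn c) else 0 : lser).
Proof.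
rewrite /qbinom; case: ifP => // /andP[/natrP[a ta] /natrP[b cb]].
have -> : t = (a + b)%:R by rewrite natrD -ta -cb subrK.
rewrite natrD cb addrK -natrD !natrK /gbin leq_addl addnK !qpochE.
have -> : qinv (lpoch a ** lpoch b) = hpoch a * hpoch b.
  rewrite -lmulE; apply: qinvE.
    by apply: ordge_1subM => //; exact: ordge_1sub_lpoch.
  by rewrite mulrACA !mul_hpoch mulr1.
by rewrite -lmulE -mulrA [hpoch b * _]mulrC.
Qed.

(** The q-binomial [z/2; m], set to 0 when z is odd or an entry is negative. The upper entry is kept
    doubled because it is half of an integer along a chain; the vanishing for odd z later encodes
    the parity condition on m, and the vanishing for negative entries allows sums over all
    integers. *)
Definition hbin (z m : int) : lser :=
  match z, m with
  | Posz a, Posz b => if odd a then 0 else gbin a./2 b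
  | _, _ => 0
  end.

Lemma ordge_hbin z m : ordge 0 (hbin z m).
Proof.
case: z m => [a|a] [b|b] /=; try exact: ordge0.
by case: ifP => _; [exact: ordge0|exact: ordge_gbin].
Qed.

Lemma hbin_neg z m : m < 0 -> hbin z m = 0.
Proof. by case: m z => [m|m] [z|z]. Qed.

(** Positivity of z excludes z = m = 0, where the left side is 1 and the right side 0. This is why
    nonnegative vertices must be kept track of below. *)
Lemma hbin_pascal (z m : int) : 0 < z ->
  hbin z m = hbin (z - 2) (m - 1) + lq m%:~R * hbin (z - 2) m.
Proof.
case: z => [[|[|a]]|a] // _.
  by case: m => [m|m] /=; rewrite mulr0 addr0.
have -> : a.+2%:Z - 2 = a by lia.
case: m => [[|m]|m] /=; first by rewrite negbK lq0 mul1r !gbin0 add0r.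
  rewrite subn1 /= negbK; case: ifP => _; first by rewrite mulr0 addr0.
  exact: gbinS.
by rewrite mulr0 addr0.
Qed.

#[global] Opaque lq gbin lpoch hpoch linv lpoch_infty hpoch_infty lsum lmul ladd lopp.

(** * Quarter-square weights *)

Lemma finite_int_abs (e : rat) : finite_set [set t : int | `|t|%:~R < e].
Proof.
have fin := finite_nat_lt e; apply: sub_finite_set
  (_ : finite_set ((fun n : nat => n%:Z) @` [set n : nat | n%:R < e] `|`
     (fun n : nat => - n%:Z) @` [set n : nat | n%:R < e])).
  move=> t /= te; case: (leP 0 t) => t0; [left|right]; exists `|t|%N => /=.
  - by rewrite pmulrn abszE.
  - by rewrite gez0_abs.
  - by rewrite pmulrn abszE.
  - by rewrite ltz0_abs // opprK.
by rewrite finite_setU; split; apply: finite_image.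
Qed.

Lemma finite_int_sqr (u : int) (e : rat) :
  finite_set [set t : int | ((t - u) ^+ 2)%:~R / 4 < e].
Proof.
apply: sub_finite_set (finite_image (fun t => t + u) (finite_int_abs (4 * e))).
move=> t /= te; exists (t - u); last by rewrite subrK.
apply: le_lt_trans (_ : ((t - u) ^+ 2)%:~R < _); last by lra.
rewrite ler_int expr2; set k := t - u; nia.
Qed.

Definition qsq (n : int) : lser := lq ((n ^+ 2)%:~R / 4).

Lemma ordge_qsq n : ordge 0 (qsq n).
Proof. by apply: ordgeW (ordge_lq _); rewrite divr_ge0 // ler0z sqr_ge0. Qed.

(** Because (n + 1)^2 / 4 - (n - 1)^2 / 4 = n. Trading q^w for q^v in this way is what makes the
    Gaussian weight compatible with the q-Pascal rule. *)
Lemma qsq_shift (v w : int) :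
  qsq (v - w + 1) * lq w%:~R = qsq (v - w - 1) * lq v%:~R.
Proof.
rewrite /qsq -!lqD; congr lq; rewrite !expr2 !rmorphM !rmorphB !rmorphD /=.
by field.
Qed.

Lemma summable_qsq (u : int) (F : int -> lser) : (forall t, ordge 0 (F t)) ->
  summable (fun t => qsq (t - u) * F t).
Proof.
move=> F0; apply: summable_ge (finite_int_sqr u) _ => t.
by apply: ordgeMl => //; exact: ordge_lq.
Qed.

Lemma subr_predr (u v : int) : u - (v - 1) = u - v + 1.
Proof. by lia. Qed.

Lemma subr_succr (u v : int) : u - (v + 1) = u - v - 1.
Proof. by lia. Qed.

(** * Chains built one vertex at a time *)

Section Transfer.
Variables (d : nat -> int) (tau : int).
Hypothesis d_ge0 : forall i, 0 <= d i.

(* Partition function of the chains m_0 = x, ..., m_i = u, m_(i+1) = v. *)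
Fixpoint transfer (x : int) (i : nat) (u v : int) : lser :=
  if i is i'.+1 then
    qsq (u - v) * lsum (fun t => transfer x i' t u * hbin (t + v + d i) u)
  else if (u == x) && ((u + v + tau) %% 2 == 0)%Z then qsq (u - v) else 0.

(** The Gaussian of the last edge factors out, and it alone makes the sums over u converge. *)
Lemma transferP x i u v : exists2 f : lser,
  ordge 0 f & transfer x i u v = qsq (u - v) * f.
Proof.
elim: i u v => [|i IH] u v /=.
  case: ifP => _; first by exists 1; rewrite ?mulr1 //; exact: ordge1.
  by exists 0; rewrite ?mulr0 //; exact: ordge0.
exists (lsum (fun t => transfer x i t u * hbin (t + v + d i.+1) u)) => //.
apply: ordge_lsum => t; have [f f0 ->] := IH t u.
exact/ordgeM0/ordge_hbin/ordgeM0/f0/ordge_qsq.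
Qed.

Lemma ordge_transfer x i u v : ordge 0 (transfer x i u v).
Proof. by have [f f0 ->] := transferP x i u v; exact/ordgeM0/f0/ordge_qsq. Qed.

Lemma summable_transfer x i u (c : int -> lser) : (forall t, ordge 0 (c t)) ->
  summable (fun t => transfer x i t u * c t).
Proof.
move=> c0; apply: summable_ge (finite_int_sqr u) _ => t; apply: ordgeMl => //.
by have [f f0 ->] := transferP x i t u; apply: ordgeMl => //; exact: ordge_lq.
Qed.

Lemma transfer_neg x i u v : 0 <= x -> u < 0 -> transfer x i u v = 0.
Proof.
move=> x0 u0; case: i => [|i] /=.
  by case: eqP => // ux; rewrite ux ltNge x0 in u0.
by rewrite (eq_lsum (G := fun=> 0)) ?lsum0 ?mulr0 // => t; rewrite hbin_neg ?mulr0.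
Qed.

Lemma lsum_transfer0 x v (c : int -> lser) :
  lsum (fun u => transfer x 0 u v * c u) = transfer x 0 x v * c x.
Proof. by rewrite (lsum1 (i0 := x)) //= => u /eqP/negPf->; rewrite mul0r. Qed.

(** [top] is a transfer step without its last Gaussian; [low] below differs by the lower entry v -
    1. They are the two terms produced by the q-Pascal rule at the vertex v. *)
Let top x i w v := lsum (fun u => transfer x i u v * hbin (u + w + d i.+1) v).

Lemma transferS x i v w : transfer x i.+1 v w = qsq (v - w) * top x i w v.
Proof. by []. Qed.

Let low x i w v := lsum (fun u => transfer x i u v * hbin (u + w + d i.+1) (v - 1)).

Lemma ordge_top x i w v : ordge 0 (top x i w v).
Proof. by apply: ordge_lsum => u; exact/ordgeM0/ordge_hbin/ordge_transfer. Qed.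

Lemma ordge_low x i w v : ordge 0 (low x i w v).
Proof. by apply: ordge_lsum => u; exact/ordgeM0/ordge_hbin/ordge_transfer. Qed.

Lemma top_neg x i w v : v < 0 -> top x i w v = 0.
Proof.
by move=> v0; rewrite /top (eq_lsum (G := fun=> 0)) ?lsum0 // => u;
  rewrite hbin_neg ?mulr0.
Qed.

Lemma low_neg x i w v : v < 0 -> low x i w v = 0.
Proof.
by move=> v0; rewrite /low (eq_lsum (G := fun=> 0)) ?lsum0 // => u;
  rewrite hbin_neg ?mulr0 //; lia.
Qed.

Lemma top_pascal x i w v : 0 <= x -> 0 <= w ->
  top x i (w + 1) v = low x i (w - 1) v + lq v%:~R * top x i (w - 1) v.
Proof.
move=> x0 w0; rewrite /top /low -lsumMl; last first.
  by apply: summable_transfer => t; exact: ordge_hbin.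
rewrite -lsumD; last 2 first.
- by apply: summable_transfer => t; exact: ordge_hbin.
- by apply/summableMl/summable_transfer => t; exact: ordge_hbin.
apply: eq_lsum => u; have [u0|u0] := ltP u 0.
  by rewrite transfer_neg // !mul0r mulr0 addr0.
rewrite hbin_pascal; last by have := d_ge0 i.+1; lia.
have -> : u + (w + 1) + d i.+1 - 2 = u + (w - 1) + d i.+1 by lia.
ring.
Qed.

(** The invariant carried along the chain: moving the start x by one step either way amounts to
    moving the current vertex v by one step either way. In the induction the shifts of u are undone
    by reindexing, Pascal is applied at u and at v, and [qsq_shift] reconciles the two powers of
    q. *)
Lemma transfer_shift x i v w : 0 <= x -> 0 <= w ->
  transfer (x + 1) i.+1 v w + (1 - lq x%:~R) * transfer (x - 1) i.+1 v w =
  qsq (v - w) * (top x i (w - 1) (v - 1) + low x i (w - 1) (v + 1)).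
Proof.
move=> x0; elim: i v w => [|i IH] v w w0.
  rewrite !transferS mulrCA -mulrDr; congr (_ * _).
  rewrite /top /low !lsum_transfer0 /=.
  rewrite !eqxx /=.
  have -> : ((x + (v - 1) + tau) %% 2 == 0)%Z = ((x + 1 + v + tau) %% 2 == 0)%Z by lia.
  have -> : ((x + (v + 1) + tau) %% 2 == 0)%Z = ((x + 1 + v + tau) %% 2 == 0)%Z by lia.
  have -> : ((x - 1 + v + tau) %% 2 == 0)%Z = ((x + 1 + v + tau) %% 2 == 0)%Z by lia.
  case: ifP => _; last by rewrite !mul0r mulr0.
  rewrite addrK hbin_pascal; last by have := d_ge0 1; lia.
  have -> : x + 1 + w + d 1 - 2 = x + (w - 1) + d 1 by lia.
  have -> : x - 1 + w + d 1 = x + (w - 1) + d 1 by lia.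
  rewrite subr_predr subr_succr.
  have -> : x + 1 - v = x - v + 1 by lia.
  have -> : x - 1 - v = x - v - 1 by lia.
  have := qsq_shift x v; set a := qsq (x - v + 1); set b := qsq (x - v - 1) => ab.
  transitivity (a * hbin (x + (w - 1) + d 1) (v - 1) +
    (a * lq v%:~R - b * lq x%:~R) * hbin (x + (w - 1) + d 1) v +
    b * hbin (x + (w - 1) + d 1) v); first by ring.
  by rewrite ab subrr mul0r addr0.
rewrite !transferS mulrCA -mulrDr; congr (_ * _).
have sT y : summable (fun u => transfer y i.+1 u v * hbin (u + w + d i.+2) v).
  by apply: summable_transfer => t; exact: ordge_hbin.
rewrite {1 2}/top -lsumMl // -lsumD //; last exact: summableMl.
(* The induction hypothesis requires v >= 0; for v < 0 every term contains a binomial with negative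
   lower entry. *)
have [v0|v0] := ltP v 0.
  rewrite (eq_lsum (G := fun=> 0)) ?lsum0; last first.
    by move=> u; rewrite hbin_neg // !mulr0 addr0.
  rewrite top_neg ?add0r; last by lia.
  rewrite /low (eq_lsum (G := fun=> 0)) ?lsum0 // => u.
  by rewrite addrK hbin_neg ?mulr0.
pose B := top x i (v - 1); pose C := low x i (v - 1).
pose H u := hbin (u + w + d i.+2) v.
have H0 u : ordge 0 (H u) by exact: ordge_hbin.
have B0 u : ordge 0 (B u) by exact: ordge_top.
have C0 u : ordge 0 (C u) by exact: ordge_low.
transitivity (lsum (fun u => qsq (u - v) * (B (u - 1) * H u)) +
              lsum (fun u => qsq (u - v) * (C (u + 1) * H u))).
  rewrite -lsumD; last 2 first.
  - by apply: summable_qsq => u; exact: ordgeM0.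
  - by apply: summable_qsq => u; exact: ordgeM0.
  apply: eq_lsum => u; rewrite mulrA -mulrDl IH // /B /C /H; ring.
rewrite (lsum_reindex_bij (h := fun u => u + 1)); last 2 first.
- by apply: summable_qsq => u; exact: ordgeM0.
- by exists (fun u => u - 1) => u; rewrite ?addrK ?subrK.
rewrite [X in _ + X](lsum_reindex_bij (h := fun u => u - 1)); last 2 first.
- by apply: summable_qsq => u; exact: ordgeM0.
- by exists (fun u => u + 1) => u; rewrite ?addrK ?subrK.
have sB : summable (fun u => qsq (u - v + 1) * (B u * H (u + 1))).
  have -> : (fun u => qsq (u - v + 1) * (B u * H (u + 1))) =
     (fun u => qsq (u - (v - 1)) * (B u * H (u + 1))).
    by apply/funext => u; rewrite subr_predr.
  by apply: summable_qsq => u; exact: ordgeM0.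
have sC : summable (fun u => qsq (u - v - 1) * (C u * H (u - 1))).
  have -> : (fun u => qsq (u - v - 1) * (C u * H (u - 1))) =
     (fun u => qsq (u - (v + 1)) * (C u * H (u - 1))).
    by apply/funext => u; rewrite subr_succr.
  by apply: summable_qsq => u; exact: ordgeM0.
have -> : (fun u => qsq (u + 1 - v) * (B (u + 1 - 1) * H (u + 1))) =
          (fun u => qsq (u - v + 1) * (B u * H (u + 1))).
  by apply/funext => u; rewrite addrK addrAC.
have -> : (fun u => qsq (u - 1 - v) * (C (u - 1 + 1) * H (u - 1))) =
          (fun u => qsq (u - v - 1) * (C u * H (u - 1))).
  by apply/funext => u; rewrite subrK addrAC.
rewrite -lsumD // {1}/top {1}/low addrK -lsumD; last 2 first.
- by apply: summable_transfer => t; exact: ordge_hbin.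
- by apply: summable_transfer => t; exact: ordge_hbin.
apply: eq_lsum => u; rewrite !transferS top_pascal // -/(B u) -/(C u) /H.
have [u0|u0] := ltP u 0.
  by rewrite /B /C top_neg // low_neg // !(mul0r, mulr0, addr0).
rewrite hbin_pascal; last by have := d_ge0 i.+2; lia.
have -> : u + 1 + w + d i.+2 - 2 = u + (w - 1) + d i.+2 by lia.
have -> : u - 1 + w + d i.+2 = u + (w - 1) + d i.+2 by lia.
rewrite subr_predr subr_succr.
set h0 := hbin _ (v - 1); set h1 := hbin _ v.
have := qsq_shift u v; set a := qsq (u - v + 1); set b := qsq (u - v - 1) => ab.
(* Pascal gives a B (h0 + q^v h1) + b C h1 on the left and a B h0 + b (C + q^u B) h1 on the right;
   they agree since a q^v = b q^u. *)
transitivity (a * B u * h0 + b * C u * h1 + (a * lq v%:~R) * B u * h1).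
  by ring.
by rewrite ab; ring.
Qed.

(** The P(x, y) of the overview, with i interior vertices. *)
Definition chainsum (i : nat) (x y : int) : lser := lsum (fun u => transfer x i u y).

Lemma chainsum0 x y : chainsum 0 x y = transfer x 0 x y.
Proof. by rewrite /chainsum (lsum1 (i0 := x)) //= => u /eqP/negPf->. Qed.

Lemma summable_chainsum i x y : summable (fun u => transfer x i u y).
Proof.
have := @summable_transfer x i y (fun=> 1) (fun=> ordge1).
by under eq_fun do rewrite mulr1.
Qed.

Lemma chainsum_rec i (x y : int) : 0 <= x -> 0 <= y ->
  chainsum i (x + 1) y + (1 - lq x%:~R) * chainsum i (x - 1) y =
  chainsum i x (y + 1) + (1 - lq y%:~R) * chainsum i x (y - 1).
Proof.
move=> x0 y0; have sT := summable_chainsum.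
case: i => [|i].
  rewrite !chainsum0 /=.
  rewrite !eqxx /=.
  have -> : ((x + (y - 1) + tau) %% 2 == 0)%Z = ((x + 1 + y + tau) %% 2 == 0)%Z by lia.
  have -> : ((x + (y + 1) + tau) %% 2 == 0)%Z = ((x + 1 + y + tau) %% 2 == 0)%Z by lia.
  have -> : ((x - 1 + y + tau) %% 2 == 0)%Z = ((x + 1 + y + tau) %% 2 == 0)%Z by lia.
  case: ifP => _; last by rewrite !mulr0.
  rewrite subr_predr subr_succr.
  have -> : x + 1 - y = x - y + 1 by lia.
  have -> : x - 1 - y = x - y - 1 by lia.
  have := qsq_shift x y; set a := qsq (x - y + 1); set b := qsq (x - y - 1) => ab.
  transitivity (a + b - b * lq x%:~R); first by ring.
  by rewrite -ab; ring.
rewrite /chainsum -(lsumMl (1 - lq x%:~R) (sT i.+1 (x - 1) y)) -lsumD; last 2 first.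
- exact: sT.
- exact/summableMl/sT.
rewrite -(lsumMl (1 - lq y%:~R) (sT i.+1 x (y - 1))) -lsumD; last 2 first.
- exact: sT.
- exact/summableMl/sT.
pose B := top x i (y - 1); pose C := low x i (y - 1).
have B0 u : ordge 0 (B u) by exact: ordge_top.
have C0 u : ordge 0 (C u) by exact: ordge_low.
(* The same scheme as in [transfer_shift], except that no binomial follows the last edge; the
   surplus terms b q^u B and a q^y B cancel by [qsq_shift]. *)
transitivity (lsum (fun u => qsq (u - y) * B (u - 1)) +
              lsum (fun u => qsq (u - y) * C (u + 1))).
  rewrite -lsumD; try exact: summable_qsq.
  by apply: eq_lsum => u; rewrite transfer_shift // mulrDr.
rewrite (lsum_reindex_bij (h := fun u => u + 1)); last 2 first.
- exact: summable_qsq.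
- by exists (fun u => u - 1) => u; rewrite ?addrK ?subrK.
rewrite [X in _ + X](lsum_reindex_bij (h := fun u => u - 1)); last 2 first.
- exact: summable_qsq.
- by exists (fun u => u + 1) => u; rewrite ?addrK ?subrK.
have -> : (fun u => qsq (u + 1 - y) * (B (u + 1 - 1))) =
          (fun u => qsq (u - (y - 1)) * B u).
  by apply/funext => u; rewrite addrK subr_predr addrAC.
have -> : (fun u => qsq (u - 1 - y) * (C (u - 1 + 1))) =
          (fun u => qsq (u - (y + 1)) * C u).
  by apply/funext => u; rewrite subrK subr_succr addrAC.
rewrite -lsumD; try exact: summable_qsq.
apply: eq_lsum => u; rewrite !transferS top_pascal // -/(B u) -/(C u).
rewrite subr_predr subr_succr.
have := qsq_shift u y; set a := qsq (u - y + 1); set b := qsq (u - y - 1) => ab.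
transitivity (b * C u + a * B u + (b * lq u%:~R) * B u - (b * lq u%:~R) * B u).
  by ring.
by rewrite -[in X in _ - X]ab; ring.
Qed.

End Transfer.

(** * Linearization of products of q-Hermite polynomials *)

Section Linearization.
Variables (d : nat -> int) (tau : int).
Hypothesis d_ge0 : forall i, 0 <= d i.
Local Notation chs := (chainsum d tau).

Definition lincoef (x y w : nat) := gbin x w * gbin y w * lpoch w.

Lemma lincoef_rec (x y w : nat) :
  lincoef x.+1 y w.+1 + lpoch w.+1 * gbin x w.+1 * gbin y w =
  lincoef x y.+1 w.+1 + lpoch w.+1 * gbin x w * gbin y w.+1.
Proof. by rewrite /lincoef !gbinS; ring. Qed.

Lemma lincoef_pred (x y w : nat) :
  (1 - lq x.+1%:R) * lincoef x y w = lpoch w.+1 * gbin x.+1 w.+1 * gbin y w.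
Proof.
by rewrite /lincoef lpochS !mulrA gbin_mulS; ring.
Qed.

(** The range n only has to exceed x, since later binomials vanish; leaving it free lets one range
    serve both x and x + 1. *)
Definition lin n (W : int -> lser) (x y : nat) : lser :=
  \sum_(w < n) lincoef x y w * W (x%:Z + y%:Z - 2 * w%:Z).

(** This is (1 - q^x) [lin] at (x - 1, y), written without the predecessor so that x = 0 is covered
    and gives 0. *)
Definition lin' n (W : int -> lser) (x y : nat) : lser :=
  \sum_(w < n) lpoch w.+1 * gbin x w.+1 * gbin y w * W (x%:Z + y%:Z - 1 - 2 * w%:Z).

Lemma lin_sym n W x y : lin n W x y = lin n W y x.
Proof.
apply: eq_bigr => w _; rewrite /lincoef [x%:Z + _]addrC.
by rewrite [gbin x w * _]mulrC.
Qed.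

Lemma lin'S n W x y : lin' n W x.+1 y = (1 - lq x.+1%:R) * lin n W x y.
Proof.
rewrite /lin' /lin mulr_sumr; apply: eq_bigr => w _.
have -> : x.+1%:Z + y%:Z - 1 - 2 * w%:Z = x%:Z + y%:Z - 2 * w%:Z by lia.
by rewrite -lincoef_pred -[LHS]mulrA.
Qed.

Lemma lin'0 n W y : lin' n W 0 y = 0.
Proof. by rewrite /lin' big1 // => w _; rewrite gbin_gt // mulr0 !mul0r. Qed.

(** All four sums involve only the values W (x + y + 1 - 2 w), so it suffices to compare
    coefficients, which is Pascal in the form of [lincoef_rec]. *)
Lemma lin_rec n W (x y : nat) : (x < n)%N ->
  lin n.+1 W x.+1 y + lin' n.+1 W x y = lin n.+1 W x y.+1 + lin' n.+1 W y x.
Proof.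
move=> lt_xn; rewrite /lin !big_ord_recl /lin' !big_ord_recr /=.
rewrite (gbin_gt (_ : (x < n.+1)%N)) ?ltnS 1?ltnW // (gbin_gt lt_xn) !(mulr0, mul0r, addr0).
rewrite -!addrA; congr (_ + _).
  rewrite /lincoef !gbin0; have -> : x.+1%:Z + y%:Z = x%:Z + y.+1%:Z by lia.
  by [].
rewrite -!big_split; apply: eq_bigr => w _ /=; rewrite /bump /= add1n.
have -> : x.+1%:Z + y%:Z - 2 * w.+1%:Z = x%:Z + y%:Z - 1 - 2 * w%:Z by lia.
have -> : x%:Z + y.+1%:Z - 2 * w.+1%:Z = x%:Z + y%:Z - 1 - 2 * w%:Z by lia.
have -> : x%:Z + (y%:Z - 1) - 2 * w%:Z = x%:Z + y%:Z - 1 - 2 * w%:Z by lia.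
have -> : y%:Z + (x%:Z - 1) - 2 * w%:Z = x%:Z + y%:Z - 1 - 2 * w%:Z by lia.
have mulDl_eq (a b c a' b' : lser) : a + b = a' + b' -> a * c + b * c = a' * c + b' * c.
  by move=> ab; rewrite -mulrDl ab mulrDl.
by apply: mulDl_eq; rewrite lincoef_rec; congr (_ + _); rewrite mulrAC.
Qed.

(* Linearization of products of continuous q-Hermite polynomials: both sides
   satisfy the recurrence [chainsum_rec]. *)
Lemma chainsum_lin i n (x y : nat) : (x < n)%N ->
  chs i x y = \sum_(w < n) gbin x w * gbin y w * lpoch w *
                     chs i 0 (x%:Z + y%:Z - 2 * w%:Z).
Proof.
case: n => // n; rewrite ltnS; rewrite -/(lin n.+1 (chs i 0) x y).
have [k] := ubnP x; elim: k x y => // k IH x y; rewrite ltnS => le_xk lt_xn.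
case: x le_xk lt_xn => [|x] lt_xk lt_xn.
  rewrite /lin big_ord_recl big1 => [|w _].
    by rewrite /lincoef !gbin0 lpoch0 !mul1r addr0 mulr0 subr0 add0r.
  by rewrite /lincoef gbin_gt // !mul0r.
have IHx (z : nat) : chs i x z = lin n.+1 (chs i 0) x z.
  by apply: IH => //; exact: ltnW.
(* Adding the (1 - q^x) term turns the goal into [chainsum_rec]. At x = 0 or y = 0 the neighbour -1
   is harmless because its factor is 1 - q^0 = 0. *)
apply: (addIr (lin' n.+1 (chs i 0) x y)); rewrite lin_rec //.
have rec := @chainsum_rec d tau d_ge0 i x y isT isT.
have e1 : x%:Z + 1 = x.+1 by lia.
have e2 : y%:Z + 1 = y.+1 by lia.
rewrite e1 e2 IHx in rec.
have -> : lin' n.+1 (chs i 0) x y = (1 - lq x%:R) * chs i (x%:Z - 1) y.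
  case: x lt_xk lt_xn {IHx rec e1} => [|x] lt_xk lt_xn.
    by rewrite lin'0 lq0 subrr mul0r.
  have -> : x.+1%:Z - 1 = x by lia.
  by rewrite lin'S -IH //; lia.
have -> : lin' n.+1 (chs i 0) y x = (1 - lq y%:R) * chs i x (y%:Z - 1).
  case: y {rec e2} => [|y]; first by rewrite lin'0 lq0 subrr mul0r.
  have -> : y.+1%:Z - 1 = y by lia.
  by rewrite lin'S lin_sym -IHx.
exact: rec.
Qed.

End Linearization.

(** * Chains as vectors *)

(** On integers |z| <= z^2, so the energy of a path dominates its displacement. Finiteness of the
    set of chains of bounded energy follows. *)
Lemma sumsq_ge (M : nat -> int) n j : (j <= n)%N ->
  `|M j - M 0%N| <= \sum_(i < n) (M i - M i.+1) ^+ 2.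
Proof.
move=> le_jn; rewrite -(subnKC le_jn) big_split_ord /=.
apply: (@le_trans _ _ (\sum_(i < j) (M i - M i.+1) ^+ 2)); last first.
  by rewrite lerDl; apply: sumr_ge0 => i _; exact: sqr_ge0.
elim: j {le_jn} => [|j IH]; first by rewrite big_ord0 subrr normr0.
rewrite big_ord_recr /= expr2.
have sq (z : int) : `|z| <= z * z by nia.
move: (sq (M j - M j.+1)).
move: ((M j - M j.+1) * _) (\sum_(_ < _) _) IH => p t; lia.
Qed.

Lemma finite_cV_lt k (B : nat) :
  finite_set [set m : 'cV[nat]_k | forall i, (m i 0%R < B)%N].
Proof.
apply: sub_finite_set (finite_image
  (fun m : 'cV['I_B]_k => map_mx (@nat_of_ord B) m) (@finite_finset _ setT)).
move=> m mB; exists (\col_i Ordinal (mB i)) => //.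
by apply/colP => i; rewrite !mxE.
Qed.

Section Extension.
Variable k : nat.

(** The path x, m_1, ..., m_k, y, constant from position k + 1 on. With x = y = 0 it also serves to
    read the coordinates of m with indices from 1. *)
Definition ext (x : int) (m : 'cV[nat]_k) (y : int) (j : nat) : int :=
  if j is i.+1 then if insub i is Some o then (m (o : 'I_k) 0)%:Z else y else x.

Lemma ext_ord x m y (i : 'I_k) : ext x m y i.+1 = m i 0.
Proof. by rewrite /ext valK. Qed.

Lemma ext_last x m y : ext x m y k.+1 = y.
Proof. by rewrite /ext insubF // ltnn. Qed.

Definition sqlen (M : nat -> int) : rat :=
  (\sum_(j < k.+1) (M j - M j.+1) ^+ 2)%:~R / 4.

Lemma finite_sqlen (x : int) (y : 'cV[nat]_k -> int) e :
  finite_set [set m : 'cV[nat]_k | sqlen (ext x m (y m)) < e].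
Proof.
pose B := (`|x| + Num.truncn (4 * e)).+2.
apply: sub_finite_set (finite_cV_lt k B) => m /= me i.
have := @sumsq_ge (ext x m (y m)) k.+1 i.+1 (ltnW (ltn_ord i)).
rewrite ext_ord /= => mi.
have : (`|(m i 0)%:Z - x| <= Num.truncn (4 * e))%R.
  have: (`|(m i 0%R)%:Z - x|%N%:R <= 4 * e :> rat).
    rewrite pmulrn abszE; set M := ext x m (y m) in me mi.
    apply: le_trans (_ : _ <= (\sum_(j < k.+1) (M j - M j.+1) ^+ 2)%:~R) _.
      by rewrite ler_int.
    by move: me; rewrite /sqlen; lra.
  by move=> h; have := le_truncn h; rewrite natrK; lia.
by rewrite /B; lia.
Qed.

End Extension.

Section AppendEntry.
Variable k : nat.

Definition rcons_cv (p : nat * 'cV[nat]_k) : 'cV[nat]_k.+1 :=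
  \col_i (if insub (i : nat) is Some j then p.2 j 0 else p.1).

Definition unrcons_cv (m : 'cV[nat]_k.+1) : nat * 'cV[nat]_k :=
  (m ord_max 0, \col_j m (widen_ord (leqnSn k) j) 0).

Lemma rcons_cvK : cancel rcons_cv unrcons_cv.
Proof.
move=> [u m]; congr pair; first by rewrite mxE insubF //= ltnn.
apply/colP => j; rewrite !mxE /=.
by have -> : insub (j : nat) = Some j by exact: valK.
Qed.

Lemma unrcons_cvK : cancel unrcons_cv rcons_cv.
Proof.
move=> m; apply/colP => i; rewrite !mxE /=.
case: insubP => [j _ ij|ik].
  by rewrite mxE; congr (m _ _); apply: val_inj.
congr (m _ _); apply: val_inj => /=.
by have := ltn_ord i; lia.
Qed.

Lemma rcons_cv_bij : bijective rcons_cv.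
Proof. by exists unrcons_cv; [exact: rcons_cvK|exact: unrcons_cvK]. Qed.

Lemma ext_rcons x (u : nat) (m : 'cV[nat]_k) v j : (j <= k.+1)%N ->
  ext x (rcons_cv (u, m)) v j = ext x m u j.
Proof.
case: j => // j; rewrite ltnS => le_jk /=.
by rewrite insubT mxE /=; case: insub.
Qed.

End AppendEntry.

Section ChainSum.
Variables (d : nat -> int) (tau : int).

Definition cweight k (M : nat -> int) : lser :=
  (if ((M 0%N + M 1%N + tau) %% 2 == 0)%Z then 1 else 0) *
  (\prod_(j < k.+1) qsq (M j - M j.+1)) *
  \prod_(j < k) hbin (M j + M j.+2 + d j.+1) (M j.+1).

Lemma eq_cweight k M M' : (forall j, (j <= k.+1)%N -> M j = M' j) ->
  cweight k M = cweight k M'.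
Proof.
move=> eqM; rewrite /cweight (eqM 0%N) // (eqM 1%N) //.
have -> : \prod_(j < k.+1) qsq (M j - M j.+1) = \prod_(j < k.+1) qsq (M' j - M' j.+1).
  by apply: eq_bigr => j _; rewrite (eqM j) ?(eqM j.+1) // ltnW.
have -> // : \prod_(j < k) hbin (M j + M j.+2 + d j.+1) (M j.+1) =
    \prod_(j < k) hbin (M' j + M' j.+2 + d j.+1) (M' j.+1).
by apply: eq_bigr => j _; have := ltn_ord j => ?;
  rewrite (eqM j) ?(eqM j.+1) ?(eqM j.+2) //; lia.
Qed.

Lemma cweightS k M : cweight k.+1 M = cweight k M *
  (qsq (M k.+1 - M k.+2) * hbin (M k + M k.+2 + d k.+1) (M k.+1)).
Proof.
rewrite /cweight [X in _ * X * _ = _]big_ord_recr [X in _ * X = _]big_ord_recr /=.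
by rewrite [_ * (_ * qsq _)]mulrA mulrACA.
Qed.

Lemma prod_qsq k (M : nat -> int) :
  \prod_(j < k.+1) qsq (M j - M j.+1) = lq (sqlen k M).
Proof.
rewrite /sqlen; elim: k.+1 => [|n IH]; first by rewrite !big_ord0 mul0r lq0.
by rewrite !big_ord_recr /= IH /qsq -lqD rmorphD mulrDl.
Qed.

Lemma ordge_cweight k M : ordge (sqlen k M) (cweight k M).
Proof.
rewrite /cweight prod_qsq; apply: ordgeMl.
  by apply: ordgeMr (ordge_lq _); case: ifP => _; [exact: ordge1|exact: ordge0].
by apply: ordge_prod => j _; exact: ordge_hbin.
Qed.

Lemma summable_cweight k x (y : 'cV[nat]_k -> int) (c : 'cV[nat]_k -> lser) :
  (forall m, ordge 0 (c m)) ->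
  summable (fun m => cweight k (ext x m (y m)) * c m).
Proof.
move=> c0; apply: summable_ge (finite_sqlen x y) _ => m.
exact/ordgeMl/c0/ordge_cweight.
Qed.

Lemma sqlen_ge0 k M : 0 <= sqlen k M.
Proof.
by rewrite /sqlen divr_ge0 // ler0z; apply: sumr_ge0 => j _; exact: sqr_ge0.
Qed.

Lemma lsum_nat_int (F : int -> lser) : summable F -> (forall t, t < 0 -> F t = 0) ->
  lsum F = lsum (fun n : nat => F n).
Proof.
move=> sF F0; rewrite (lsum_reindex (A := [set: nat]) (h := Posz)) //.
- by apply: eq_lsum => n; rewrite in_setT.
- by move=> m n _ _ [].
- by move=> [n|n] Ft; [exists n|case: Ft; exact: F0].
Qed.

(** The function [psi] of the vertex m_k makes the induction go through: when a vertex is appended,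
    the new binomial depends on m_k and becomes the next [psi]. *)
Lemma lsum_cweight k x v (psi : int -> lser) : 0 <= x ->
  (forall u, ordge 0 (psi u)) ->
  lsum (fun m : 'cV[nat]_k => cweight k (ext x m v) * psi (ext x m v k)) =
  lsum (fun u => transfer d tau x k u v * psi u).
Proof.
move=> x0; elim: k v psi => [|k IH] v psi psi0.
  rewrite lsum_transfer0 (lsum1 (i0 := 0)) => [|m nm0]; last by case: nm0; exact: flatmx0.
  rewrite /cweight big_ord_recl !big_ord0 !mulr1 /= eqxx insubF //=.
  by case: ifP => _; rewrite !(mul1r, mul0r).
rewrite (lsum_reindex_bij _ (rcons_cv_bij k)); last first.
  exact: (@summable_cweight k.+1 x (fun=> v) (fun m => psi (ext x m v k.+1))).
have E (u : nat) (m : 'cV[nat]_k) : cweight k.+1 (ext x (rcons_cv (u, m)) v) *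
    psi (ext x (rcons_cv (u, m)) v k.+1) =
  (qsq (u%:Z - v) * psi u) *
    (cweight k (ext x m u) * hbin (ext x m u k + v + d k.+1) u).
  rewrite cweightS (eq_cweight (M' := ext x m u)); last first.
    by move=> j jk; rewrite ext_rcons.
  rewrite ext_last !ext_rcons // ext_last; ring.
have sE : summable (fun p : nat * 'cV[nat]_k => (qsq (p.1%:Z - v) * psi p.1) *
    (cweight k (ext x p.2 p.1) * hbin (ext x p.2 p.1 k + v + d k.+1) p.1)).
  have := summable_comp (bij_inj (rcons_cv_bij k))
    (@summable_cweight k.+1 x (fun=> v) (fun m => psi (ext x m v k.+1)) _).
  rewrite (_ : (fun p => _) = (fun p : nat * 'cV[nat]_k => (qsq (p.1%:Z - v) * psi p.1) *
    (cweight k (ext x p.2 p.1) * hbin (ext x p.2 p.1 k + v + d k.+1) p.1))); last first.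
    by apply/funext => -[u m]; rewrite E.
  by apply.
rewrite (eq_lsum (G := fun p : nat * 'cV[nat]_k => (qsq (p.1%:Z - v) * psi p.1) *
    (cweight k (ext x p.2 p.1) * hbin (ext x p.2 p.1 k + v + d k.+1) p.1))); last first.
  by move=> [u m]; rewrite E.
rewrite (lsum_pair (F := fun u m => (qsq (u%:Z - v) * psi u) *
    (cweight k (ext x m u) * hbin (ext x m u k + v + d k.+1) u))) //.
rewrite [RHS]lsum_nat_int; last 2 first.
- exact: summable_transfer.
- by move=> t t0; rewrite transfer_neg ?mul0r.
apply: eq_lsum => u; rewrite lsumMl; last first.
  apply: (@summable_cweight k x (fun=> u%:Z)
    (fun m => hbin (ext x m u k + v + d k.+1) u)) => m.
  exact: ordge_hbin.
rewrite (IH u (fun t => hbin (t + v + d k.+1) u)) => [|t]; last exact: ordge_hbin.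
by rewrite mulrAC.
Qed.

Lemma chainsumE k x y : 0 <= x ->
  chainsum d tau k x y = lsum (fun m : 'cV[nat]_k => cweight k (ext x m y)).
Proof.
move=> x0; have := lsum_cweight k y x0 (psi := fun=> 1) (fun=> ordge1).
rewrite /chainsum (eq_lsum (G := fun m => cweight k (ext x m y))) => [->|m].
  by apply: eq_lsum => u; rewrite mulr1.
by rewrite mulr1.
Qed.

End ChainSum.

Lemma ordge_prod_sub e n (F G : 'I_n -> lser) : (forall i, ordge 0 (F i)) ->
  (forall i, ordge 0 (G i)) -> (forall i, ordge e (F i - G i)) ->
  ordge e (\prod_(i < n) F i - \prod_(i < n) G i).
Proof.
elim: n F G => [|n IH] F G F0 G0 FG.
  by rewrite !big_ord0 subrr; exact: ordge0.
rewrite !big_ord_recl.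
have -> (a b c d : lser) : a * b - c * d = (a - c) * b + c * (b - d) by ring.
apply: ordgeD.
  by apply: ordgeMl => //; apply: ordge_prod.
by apply: ordgeMr => //; apply: IH.
Qed.

Lemma lser_eq_ord_nat (f g : lser) : (forall E : nat, ordge E%:R (f - g)) -> f = g.
Proof.
move=> fg; apply: lser_eq_ord => e; apply: ordgeW (fg (Num.truncn e).+1).
exact/ltW/truncnS_gt.
Qed.

(** * The limit of a chain far from the origin *)

Section Stable.
Variables (d : nat -> int) (tau : int) (k : nat).
Hypothesis d01 : forall i, 0 <= d i <= 1.
Let d_ge0 i : 0 <= d i. Proof. by case/andP: (d01 i). Qed.
Implicit Types (n m : 'cV[nat]_k) (a c x y : int) (j : nat).

(* The heights mu_j relative to m_0 determined by the slope c = mu_1 and the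
   vector n, via mu_(j-1) + mu_(j+1) + d_j = 2 mu_j + 2 n_j. *)
Fixpoint height2 c n j : int * int :=
  if j is i.+1 then
    let: (u, v) := height2 c n i in (v, 2 * v + 2 * ext 0 n 0 i.+1 - u - d i.+1)
  else (0, c).

Definition height c n j : int := (height2 c n j).1.

Lemma heightS c n j : height c n j.+1 = (height2 c n j).2.
Proof. by rewrite /height /=; case: height2. Qed.

Lemma height0 c n : height c n 0 = 0. Proof. by []. Qed.
Lemma height1 c n : height c n 1 = c. Proof. by []. Qed.

Lemma height_rec c n j :
  height c n j.+2 = 2 * height c n j.+1 + 2 * ext 0 n 0 j.+1 - height c n j - d j.+1.
Proof. by rewrite !heightS /= /height; case: height2. Qed.

Lemma ind2 (P : nat -> Prop) : P 0%N -> P 1%N ->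
  (forall j, P j -> P j.+1 -> P j.+2) -> forall j, P j.
Proof.
move=> P0 P1 PS j; suff [] : P j /\ P j.+1 by [].
by elim: j => [|j [Pj PSj]]; split=> //; exact: PS.
Qed.

Lemma height_slope c n j : height c n j = j%:Z * c + height 0 n j.
Proof.
elim/ind2: j => [||j IH IHS]; rewrite ?height0 ?height1; try lia.
by rewrite !height_rec IH IHS; lia.
Qed.

(* The only slope for which the height at k+1 can be a: that height is affine
   in the slope, with leading coefficient k+1. *)
Definition slope a n : int := ((a - height 0 n k.+1) %/ k.+1%:Z)%Z.

(** The first condition says that the division in [slope] is exact; the second is the parity of m_0
    + m_1 = 2 x + slope. *)
Definition admissible a n : Prop :=
  height (slope a n) n k.+1 = a /\ ((slope a n + tau) %% 2 = 0)%Z.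

Lemma slope_uniq a c n : height c n k.+1 = a -> slope a n = c.
Proof.
rewrite height_slope /slope => <-; rewrite addrK mulrC mulzK //.
Qed.

Lemma height_bound c n j : (j <= k.+1)%N -> `|height c n j|%:~R <= 4 * sqlen k (height c n).
Proof.
move=> jk; have := sumsq_ge (height c n) jk.
by rewrite height0 subr0 /sqlen -(ler_int rat) => h; rewrite [4 * _]mulrC mulfVK.
Qed.

(** A parafermionic character: the limit of [chainsum] at (x, x + a), where each binomial has become
    1/(q)_(n_i). *)
Definition paraf a : lser :=
  lsum (fun n => if `[< admissible a n >] then
    lq (sqlen k (height (slope a n) n)) * \prod_(i < k) hpoch (n i 0%R) else 0).

Lemma ordge_paraf a : ordge 0 (paraf a).
Proof.
apply: ordge_lsum => n; case: ifP => _; last exact: ordge0.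
apply: ordgeMl; first exact: ordgeW (sqlen_ge0 _ _) (ordge_lq _).
by apply: ordge_prod => j _; exact: ordge_hpoch.
Qed.

Lemma summable_paraf a : summable (fun n => if `[< admissible a n >] then
    lq (sqlen k (height (slope a n) n)) * \prod_(i < k) hpoch (n i 0%R) else 0).
Proof.
(* If all heights are at most B = [truncn (4 * e)] in absolute value, [height_rec] gives 2 n_i <= 4
   B + 1; the bound used is a generous one. *)
move=> e; apply: sub_finite_set (finite_cV_lt k (8 * Num.truncn (4 * e) + 2)) => n /=.
case: ifPn => [_ ne i|_ []]; last exact: ordge0.
set c := slope a n in ne; have lt_e : sqlen k (height c n) < e.
  rewrite ltNge; apply/negP => le_e; apply: ne; apply: ordgeMl.
    exact: ordgeW le_e (ordge_lq _).
  by apply: ordge_prod => j _; exact: ordge_hpoch.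
have hb j : (j <= k.+1)%N -> (`|height c n j|%N <= Num.truncn (4 * e))%N.
  move=> jk; rewrite -[leqLHS](@natrK rat); apply: le_truncn.
  by rewrite pmulrn abszE; have := height_bound c n jk; lra.
have ik := ltn_ord i.
have := height_rec c n i; rewrite ext_ord.
have := hb i; have := hb i.+1; have := hb i.+2; have := d_ge0 i.+1.
have /andP[_] := d01 i.+1.
move: (height c n i) (height c n i.+1) (height c n i.+2) (n i 0).
move: (Num.truncn _) => B; lia.
Qed.

Definition shifted x a n : 'cV[nat]_k :=
  \col_i absz (x + height (slope a n) n i.+1).

(** The n that are already realized at finite x, their path staying nonnegative. On them [shifted]
    is injective, and it reaches every chain of nonzero weight. *)
Definition visible x a n : Prop :=
  admissible a n /\ forall j, (j < k)%N -> 0 <= x + height (slope a n) n j.+1.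

Lemma ext_shifted x a n j : visible x a n -> (j <= k.+1)%N ->
  ext x (shifted x a n) (x + a) j = x + height (slope a n) n j.
Proof.
move=> [[na _] npos]; case: j => [|j] jk /=; first by rewrite height0 addr0.
case: insubP => [i jk' ij|]; first by rewrite mxE ij gez0_abs //; exact: npos.
move=> kj; have -> : j = k by lia.
by rewrite na.
Qed.

Lemma shifted_inj x a : {in [set n | visible x a n] &, injective (shifted x a)}.
Proof.
move=> n n'; rewrite !in_setE /= => vn vn' eqs; apply/colP => i.
have eqh j : (j <= k.+1)%N -> height (slope a n) n j = height (slope a n') n' j.
  move=> jk; have := ext_shifted vn jk; rewrite eqs (ext_shifted vn' jk); lia.
have := height_rec (slope a n) n i; have := height_rec (slope a n') n' i.
have ik := ltn_ord i.
by rewrite !eqh ?ext_ord //; lia.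
Qed.

Lemma hbin_neq0 (z m : int) : hbin z m <> 0 ->
  exists p q : nat, z = 2 * (p + q)%:Z /\ m = p.
Proof.
case: z m => [z|z] [m|m] //=; case: ifPn => // zev.
case: (leqP m z./2) => [mz _|/gbin_gt->//]; exists m, (z./2 - m)%N; split => //.
by rewrite subnKC //; lia.
Qed.

Lemma hbinE (p q : nat) : hbin (2 * (p + q)%:Z) p = gbin (p + q) p.
Proof.
have -> : 2 * (p + q)%:Z = (p + q).*2 by lia.
by rewrite /= odd_double doubleK.
Qed.

Lemma shifted_surj x a m : cweight d tau k (ext x m (x + a)) <> 0 ->
  exists2 n, visible x a n & shifted x a n = m.
Proof.
set M := ext x m (x + a) => M0.
have par : ((M 0%N + M 1%N + tau) %% 2 = 0)%Z.
  apply/eqP; apply: contra_notT M0 => /negPf par.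
  by rewrite /cweight par !mul0r.
have hM (i : 'I_k) : hbin (M i + M i.+2 + d i.+1) (M i.+1) <> 0.
  move=> hM; apply: M0; rewrite /cweight (bigD1 i) //= hM.
  by rewrite mul0r mulr0.
(* The complementary entry of each binomial; it is integral and nonnegative because the binomial
   does not vanish. *)
pose n : 'cV[nat]_k :=
  \col_i absz (((M i + M i.+2 + d i.+1) %/ 2)%Z - M i.+1).
have nE (i : 'I_k) : 2 * (n i 0%R)%:Z = M i + M i.+2 + d i.+1 - 2 * M i.+1.
  have [p [q [zE Mi]]] := hbin_neq0 (hM i); rewrite mxE zE Mi; lia.
pose c := M 1%N - x.
have hE j : (j <= k.+1)%N -> height c n j = M j - x.
  elim/ind2: j => [||j IH IHS] jk; rewrite ?height0 ?height1 //; first by rewrite /M /=; lia.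
  have jk' : (j < k)%N by lia.
  have nEj : 2 * (n (Ordinal jk') 0%R)%:Z = M j + M j.+2 + d j.+1 - 2 * M j.+1 :=
    nE (Ordinal jk').
  rewrite height_rec IH ?IHS; try lia.
  by rewrite (ext_ord 0 n 0 (Ordinal jk')); lia.
have na : slope a n = c.
  by apply: slope_uniq; rewrite hE // /M ext_last; lia.
have vn : visible x a n.
  have M0E : M 0%N = x by [].
  have MlE : M k.+1 = x + a by exact: ext_last.
  split; first by rewrite /admissible na hE // /c; split; lia.
  move=> j jk; rewrite na hE; last lia.
  by rewrite /M (ext_ord x m _ (Ordinal jk)); lia.
exists n => //; apply/colP => i; rewrite mxE na hE; last exact: ltnW (ltn_ord i).
by rewrite /M ext_ord; lia.
Qed.

(** The binomials are rewritten with lower entry n_j instead of m_j: n_j stays fixed as x grows, as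
    [gbin_stable] requires. *)
Lemma shifted_weight x a n : visible x a n ->
  cweight d tau k (ext x (shifted x a n) (x + a)) =
  lq (sqlen k (height (slope a n) n)) *
  \prod_(i < k) gbin (absz (x + height (slope a n) n i.+1) + n i 0%R) (n i 0%R).
Proof.
move=> vn; have [[na par] npos] := vn; rewrite /cweight prod_qsq.
have hE := ext_shifted vn; rewrite !hE // height0 height1 addr0.
have -> : ((x + (x + slope a n) + tau) %% 2 == 0)%Z by apply/eqP; lia.
have -> : sqlen k (ext x (shifted x a n) (x + a)) =
    sqlen k (height (slope a n) n).
  rewrite /sqlen; congr (_%:~R / _); apply: eq_bigr => j _.
  have jk := ltn_ord j; rewrite !hE //; last exact: ltnW.
  by congr (_ ^+ 2); lia.
rewrite mul1r.
suff -> : \prod_(j < k) hbin (ext x (shifted x a n) (x + a) j +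
    ext x (shifted x a n) (x + a) j.+2 + d j.+1) (ext x (shifted x a n) (x + a) j.+1) =
  \prod_(i < k) gbin (absz (x + height (slope a n) n i.+1) + n i 0%R) (n i 0%R) by [].
apply: eq_bigr => j _; have jk := ltn_ord j.
rewrite !hE; try lia.
rewrite -gbin_sym -hbinE gez0_abs; last exact: npos.
congr hbin; rewrite height_rec ext_ord PoszD gez0_abs; [lia|exact: npos].
Qed.

(** Paths of energy at least E contribute O(q^E) to both sides. For the others all heights are at
    most 4 E in absolute value, so x >= 5 E leaves m_j >= E, and each binomial agrees with
    1/(q)_(n_j) modulo O(q^E). *)
Lemma chainsum_stable E x a : E%:Z * 5 <= x -> 
  ordge E%:R (chainsum d tau k x (x + a) - paraf a).
Proof.
move=> xE; rewrite chainsumE //; last by lia.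
have sC : summable (fun m => cweight d tau k (ext x m (x + a))).
  have := @summable_cweight d tau k x (fun=> x + a) (fun=> 1) (fun=> ordge1).
  by under eq_fun do rewrite mulr1.
rewrite (lsum_reindex sC (@shifted_inj x a)); last first.
  by move=> m /shifted_surj[n vn nm]; exists n.
rewrite /paraf -lsumB; last 2 first.
- exact: summable_reindex sC (@shifted_inj x a).
- exact: summable_paraf.
apply: ordge_lsum => n; set S := sqlen k (height (slope a n) n).
have P0 : ordge 0 (\prod_(i < k) hpoch (n i 0%R)).
  by apply: ordge_prod => j _; exact: ordge_hpoch.
have [an|nan] := pselect (admissible a n); last first.
  rewrite ifN; last by apply/negP; rewrite in_setE => -[].
  by rewrite asboolF // subrr; exact: ordge0.
rewrite asboolT //; have [le_ES|lt_SE] := leP E%:R S.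
  apply: ordgeB; last by apply: ordgeMl => //; apply: ordgeW le_ES (ordge_lq _).
  case: ifP => [|_]; last exact: ordge0.
  rewrite in_setE => vn; rewrite shifted_weight //; apply: ordgeMl.
    exact: ordgeW le_ES (ordge_lq _).
  by apply: ordge_prod => j _; exact: ordge_gbin.
have hb j : (j <= k.+1)%N -> `|height (slope a n) n j| <= 4 * E%:Z.
  move=> jk; rewrite -(ler_int rat); apply: le_trans (height_bound _ _ jk) _.
  by rewrite rmorphM /= -/S -pmulrn; lra.
have vn : visible x a n.
  by split => // j jk; have := hb j.+1 (ltnW jk); lia.
rewrite ifT; last by rewrite in_setE.
rewrite shifted_weight // -mulrBr; apply: ordgeMr.
  exact: ordgeW (sqlen_ge0 _ _) (ordge_lq _).
apply: ordge_prod_sub => [j|j|j].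
- exact: ordge_gbin.
- exact: ordge_hpoch.
- apply: ordgeW (gbin_stable _ _); rewrite ler_nat.
  by have := hb j.+1 (ltnW (ltn_ord j)); lia.
Qed.

End Stable.

(** * The kernel and the spinon formula *)

(** 1/(q)_(z/2), read as 0 when z/2 is negative or not an integer. *)
Definition hhalf (z : int) : lser :=
  if z is Posz n then if odd n then 0 else hpoch n./2 else 0.

Lemma ordge_hhalf z : ordge 0 (hhalf z).
Proof.
by case: z => [n|n] /=; [case: ifP => _|]; try exact: ordge0; exact: ordge_hpoch.
Qed.

Lemma hhalfE (n : nat) z : z = 2 * n%:Z -> hhalf z = hpoch n.
Proof.
move=> ->; have -> : 2 * n%:Z = n.*2 by lia.
by rewrite /= odd_double doubleK.
Qed.

Lemma hhalf_neq0 z : hhalf z <> 0 -> exists n : nat, z = 2 * n%:Z.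
Proof. by case: z => n //=; case: ifPn => // ev _; exists n./2; lia. Qed.

Lemma hhalf_neg z : z < 0 -> hhalf z = 0.
Proof. by case: z. Qed.

(* 1 / ((q)_((L - a) / 2) (q)_((L + a) / 2)) *)
Definition bkernel (L a : int) : lser := hhalf (L - a) * hhalf (L + a).

Lemma ordge_bkernel L a : ordge 0 (bkernel L a).
Proof. by apply: ordgeM0; exact: ordge_hhalf. Qed.

Lemma bkernelN L a : bkernel L (- a) = bkernel L a.
Proof. by rewrite /bkernel opprK mulrC. Qed.

Lemma bkernel_neq0 L a : bkernel L a <> 0 ->
  exists p r : nat, L - a = 2 * p%:Z /\ L + a = 2 * r%:Z.
Proof.
move=> nz; have [|p pE] := @hhalf_neq0 (L - a).
  by move=> h0; apply: nz; rewrite /bkernel h0 mul0r.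
have [|r rE] := @hhalf_neq0 (L + a).
  by move=> h0; apply: nz; rewrite /bkernel h0 mulr0.
by exists p, r.
Qed.

Section Spinon.
Variables (d : nat -> int) (tau : int) (k : nat).
Hypothesis d01 : forall i, 0 <= d i <= 1.
Let d_ge0 i : 0 <= d i. Proof. by case/andP: (d01 i). Qed.

Lemma ordge_chainsum0 (L : int) : ordge (`|L|%:~R / 4) (chainsum d tau k 0 L).
Proof.
rewrite chainsumE //; apply: ordge_lsum => m.
apply: ordgeW (ordge_cweight d tau k _).
rewrite /sqlen ler_pM2r ?invr_gt0 // ler_int.
by have := @sumsq_ge (ext 0 m L) k.+1 k.+1 (leqnn _); rewrite ext_last subr0.
Qed.

Lemma finite_int_abs4 (e : rat) : finite_set [set t : int | `|t|%:~R / 4 < e].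
Proof. by apply: sub_finite_set (finite_int_abs (4 * e)) => t /=; lra. Qed.

Let T a (L : int) := bkernel L a * chainsum d tau k 0 L.

Let ordge_T a L : ordge (`|L|%:~R / 4) (T a L).
Proof. apply: ordgeMr (ordge_bkernel L a) (ordge_chainsum0 L). Qed.

Lemma summable_bkernel a : summable (T a).
Proof. exact: summable_ge finite_int_abs4 (ordge_T a). Qed.

(** Divided by (q)_x (q)_y, the coefficient [x; w] [y; w] (q)_w becomes 1/((q)_w (q)_(x-w)
    (q)_(y-w)). With L = x + y - 2 w one has x - w = (L - a)/2 and y - w = (L + a)/2. *)
Lemma chainsum_bkernel a (x y : nat) : y%:Z = x%:Z + a ->
  hpoch x * hpoch y * chainsum d tau k x y =
  lsum (fun L : int => hhalf (x%:Z + y%:Z - L) * T a L).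
Proof.
move=> ya.
rewrite (lsum_reindex (A := [set w : nat | (w < x.+1)%N])
  (h := fun w : nat => x%:Z + y%:Z - 2 * w%:Z)); last 3 first.
- apply: summable_ge finite_int_abs4 _ => L.
  exact: ordgeMr (ordge_hhalf _) (ordge_T a L).
- by move=> w w' _ _; lia.
- move=> L nz; have [w wE] : exists w : nat, x%:Z + y%:Z - L = 2 * w%:Z.
    by apply: hhalf_neq0 => h0; apply: nz; rewrite h0 mul0r.
  have [p [r [pE rE]]] : exists p r : nat, L - a = 2 * p%:Z /\ L + a = 2 * r%:Z.
    by apply: bkernel_neq0 => h0; apply: nz; rewrite /T h0 mul0r mulr0.
  by exists w => /=; lia.
rewrite (lsum_ord (n := x.+1)) => [|w xw]; last first.
  by rewrite ifN //; apply/negP; rewrite in_setE /= ltnNge xw.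
rewrite (@chainsum_lin d tau d_ge0 k x.+1 x y (ltnSn x)) mulr_sumr.
apply: eq_bigr => w _; have lt_wx := ltn_ord w; rewrite ifT; last by rewrite in_setE.
rewrite (hhalfE (n := w)); last by lia.
rewrite /T; set W := chainsum d tau k 0 _; rewrite /bkernel.
rewrite (hhalfE (n := (x - w)%N)); last by lia.
have [le_wy|lt_yw] := leqP w y; last first.
  by rewrite (gbin_gt lt_yw) hhalf_neg ?(mulr0, mul0r) //; lia.
rewrite (hhalfE (n := (y - w)%N)); last by lia.
have := gbin_fact w (x - w); rewrite subnKC // => ->.
have := gbin_fact w (y - w); rewrite subnKC // => ->.
have := mul_hpoch x; have := mul_hpoch y; have := mul_hpoch w.
move: (hpoch x) (lpoch x) (hpoch y) (lpoch y) (hpoch w) (lpoch w) W.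
move: (hpoch (x - w)) (hpoch (y - w)) => a1 a2 b1 b2 b3 b4 b5 b6 W e1 e2 e3.
transitivity ((b2 * b1) * (b4 * b3) * (b6 * b5) * (b5 * a1 * a2 * W)); first by ring.
by rewrite e1 e2 e3; ring.
Qed.

(* Spinon formula for the string functions: the higher-level conjugate Bailey
   pair.  It is the limit x -> oo, y = x + a of [chainsum_lin]. *)
Theorem spinon a :
  lsum (fun L : int => bkernel L a * chainsum d tau k 0 L) =
  hpoch_infty * paraf d tau k a.
Proof.
(* The extra invertible factor 1/(q)_oo is the limit of the 1/(q)_w left over in
   [chainsum_bkernel]. *)
rewrite -/(T a); suff h : hpoch_infty * lsum (T a) = hpoch_infty * (hpoch_infty * paraf d tau k a).
  rewrite -[LHS]mul1r -mul_hpoch_infty -mulrA h.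
  by rewrite mulrA mul_hpoch_infty mul1r.
apply: lser_eq_ord_nat => E.
(* 5 E is the threshold of [chainsum_stable]; adding |a| keeps y = x + a above it as well. *)
pose x := (5 * E + absz a)%N; pose y := absz (x%:Z + a).
have ya : y%:Z = x%:Z + a by rewrite /y /x; lia.
have sT := summable_bkernel a.
have sT' : summable (fun L => hhalf (x%:Z + y%:Z - L) * T a L).
  apply: summable_ge finite_int_abs4 _ => L.
  exact: ordgeMr (ordge_hhalf _) (ordge_T a L).
have D1 : ordge E%:R (hpoch_infty * lsum (T a) -
    hpoch x * hpoch y * chainsum d tau k x y).
  rewrite (chainsum_bkernel ya) -lsumMl // -lsumB //; last exact: summableMl.
  apply: ordge_lsum => L; rewrite -mulrBl.
  have [b0|/eqP nz] := eqVneq (bkernel L a) 0.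
    by rewrite /T b0 mul0r mulr0; exact: ordge0.
  have [p [r [pE rE]]] : exists p r : nat, L - a = 2 * p%:Z /\ L + a = 2 * r%:Z.
    exact: bkernel_neq0.
  (* For L >= 4 E the term already has order L/4 >= E. Otherwise w = x - p is at least E, so 1/(q)_w
     agrees with 1/(q)_oo to the order needed. *)
  have [le_L|lt_L] := leP (4 * E)%N%:Z L.
    apply: ordgeMr.
      by apply: ordgeB; [exact: ordge_hpoch_infty|exact: ordge_hhalf].
    apply: ordgeW (ordge_T a L); rewrite ler_pdivlMr // pmulrn.
    by rewrite -[4]/(4%:~R) -rmorphM ler_int; lia.
  rewrite (hhalfE (n := absz (x%:Z - p%:Z))); last by rewrite /x; lia.
  apply: ordgeMl; last first.
    by apply: ordgeW (ordge_T a L); rewrite divr_ge0 // ler0z.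
  rewrite -opprB; apply/ordgeN/(ordgeW _ (hpoch_stable _)).
  by rewrite ler_nat /x; lia.
have D2 : ordge E%:R (hpoch x * hpoch y * chainsum d tau k x y -
    hpoch_infty * (hpoch_infty * paraf d tau k a)).
  have -> : hpoch x * hpoch y * chainsum d tau k x y -
      hpoch_infty * (hpoch_infty * paraf d tau k a) =
    hpoch x * hpoch y * (chainsum d tau k x y - paraf d tau k a) +
    (hpoch x * (hpoch y - hpoch_infty) + (hpoch x - hpoch_infty) * hpoch_infty)
      * paraf d tau k a by ring.
  have p0 := ordge_paraf d tau k a.
  apply: ordgeD.
    apply: ordgeMr; first by apply: ordgeM0; exact: ordge_hpoch.
    by rewrite ya; apply: chainsum_stable => //; rewrite /x; lia.
  apply: ordgeMl => //; apply: ordgeD.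
    apply: ordgeMr (ordge_hpoch x) (ordgeW _ (hpoch_stable y)).
    by rewrite ler_nat /y /x; lia.
  apply: ordgeMl ordge_hpoch_infty.
  by apply: ordgeW (hpoch_stable x); rewrite ler_nat /x; lia.
by have := ordgeD D1 D2; rewrite addrA subrK.
Qed.

(** The symmetry of string functions under m -> -m. It is not visible on the sum over n, but the
    spinon side depends on a only through the even kernel. *)
Lemma parafN a : paraf d tau k (- a) = paraf d tau k a.
Proof.
have /(congr1 (fun f => lpoch_infty * f)) := spinon (- a).
rewrite mulrA mul_hpoch_infty mul1r => <-.
under eq_lsum do rewrite bkernelN.
by rewrite spinon mulrA mul_hpoch_infty mul1r.
Qed.

End Spinon.

(** * Second differences and the inverse Cartan matrix *)

Section SecondDifferences.
Variables (R : comPzRingType) (F : nat -> R).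
Hypothesis F0 : F 0%N = 0.
Let D2 i := 2 * F i.+1 - F i - F i.+2.

(** Discrete summation by parts. The boundary term vanishes when F n = F (n + 1), the situation at
    the loop of the tadpole. *)
Lemma sum_mul_diff2 n : \sum_(i < n) F i.+1 * D2 i =
  \sum_(i < n) (F i - F i.+1) ^+ 2 + F n * (F n - F n.+1).
Proof.
elim: n => [|n IH]; first by rewrite !big_ord0 F0 mul0r addr0.
by rewrite !big_ord_recr /= IH /D2; ring.
Qed.

Lemma sum_index_diff2 n : \sum_(i < n) i.+1%:R * D2 i = n.+1%:R * F n - n%:R * F n.+1.
Proof.
elim: n => [|n IH]; first by rewrite big_ord0 F0 mulr0 mul0r subr0.
by rewrite big_ord_recr /= IH /D2 -!natr1; ring.
Qed.

(** For n = N - 1 the weights n - i are N times the first row of the inverse Cartan matrix, whence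
    the link with (C^{-1} n)_1. *)
Lemma sum_coindex_diff2 n : \sum_(i < n) (n - i)%:R * D2 i = n.+1%:R * F 1%N - F n.+1.
Proof.
elim: n => [|n IH]; first by rewrite big_ord0 mul1r subrr.
have tel m : \sum_(i < m) D2 i = F 1%N + F m - F m.+1.
  elim: m => [|m IHm]; first by rewrite big_ord0 F0 addr0 subrr.
  by rewrite big_ord_recr /= IHm /D2; ring.
have -> : \sum_(i < n.+1) (n.+1 - i)%:R * D2 i =
    \sum_(i < n.+1) (n - i)%:R * D2 i + \sum_(i < n.+1) D2 i.
  rewrite -big_split; apply: eq_bigr => i _ /=.
  have le_in : (i <= n)%N by have := ltn_ord i; lia.
  by rewrite subSn // -natr1 mulrDl mul1r.
by rewrite big_ord_recr /= subnn mul0r addr0 IH tel -!natr1; ring.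
Qed.

End SecondDifferences.

Lemma sum_neighbours (R : pzRingType) k (F : nat -> R) (i : 'I_k) :
  F 0%N = 0 -> F k.+1 = 0 ->
  \sum_(j < k) (`|i%:Z - j%:Z|%N == 1%N)%:R * F j.+1 = F i + F i.+2.
Proof.
move=> F0 Fk; have lt_ik := ltn_ord i.
transitivity (\sum_(j < k) ((j.+1 == i :> nat)%:R * F i + (j == i.+1 :> nat)%:R * F i.+2)).
  apply: eq_bigr => j _.
  case: (eqVneq j.+1 i) => [e|ne1].
    have -> : (`|i%:Z - j%:Z|%N == 1%N) by lia.
    have -> : (j == i.+1 :> nat) = false by lia.
    by rewrite e mul0r addr0.
  case: (eqVneq (j : nat) i.+1) => [e|ne2].
    have -> : (`|i%:Z - j%:Z|%N == 1%N) by lia.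
    by rewrite e mul0r add0r.
  have -> : (`|i%:Z - j%:Z|%N == 1%N) = false by lia.
  by rewrite !mul0r addr0.
rewrite big_split /= -!mulr_suml; congr (_ + _).
  case: (posnP i) => [-> |i_gt0]; first by rewrite F0 mulr0.
  have lt_ik1 : (i.-1 < k)%N by lia.
  rewrite (bigD1 (Ordinal lt_ik1)) //= prednK // eqxx big1 ?addr0 ?mul1r // => j.
  by move=> /eqP ji; case: eqP => // e; case: ji; apply: val_inj => /=; lia.
case: (ltnP i.+1 k) => [lt_ik1|le_ki]; last first.
  by have -> : i.+2 = k.+1 by [lia]; rewrite Fk mulr0.
rewrite (bigD1 (Ordinal lt_ik1)) //= eqxx big1 ?addr0 ?mul1r // => j.
by move=> /eqP ji; case: eqP => // e; case: ji; apply: val_inj.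
Qed.

Lemma bilinE k (v w : 'cV[rat]_k) (M : 'M_k) : bilin v M w = \sum_i v i 0 * (M *m w) i 0.
Proof. by rewrite /bilin -mulmxA mxE; apply: eq_bigr => i _; rewrite mxE. Qed.

Lemma bilin_sym k (v w : 'cV[rat]_k) (M : 'M_k) : M^T = M -> bilin v M w = bilin w M v.
Proof.
move=> Msym; rewrite /bilin.
have -> : w^T *m M *m v = (v^T *m M *m w)^T by rewrite !trmx_mul trmxK Msym mulmxA.
by rewrite [RHS]mxE.
Qed.

(** The Green function of the second difference on 0, ..., N with zero boundary values; its interior
    entries form the inverse Cartan matrix of A_(N-1). *)
Definition green (N i j : nat) : rat := (minn i j)%:R * (N - maxn i j)%:R / N%:R.

Lemma green_diff2 N i j : (0 < j < N)%N -> (i.+1 < N)%N ->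
  2 * green N i.+1 j - green N i j - green N i.+2 j = (i.+1 == j)%:R.
Proof.
move=> /andP[j0 jN] iN; have N0 : N%:R != 0 :> rat by rewrite pnatr_eq0; lia.
rewrite /green.
have [lt|[gt|eq]] : (i.+1 < j)%N \/ (j < i.+1)%N \/ i.+1 = j by lia.
- rewrite ltn_eqF //= mulr0n; have -> : minn i.+1 j = i.+1 by lia.
  have -> : minn i j = i by lia.
  have -> : minn i.+2 j = i.+2 by lia.
  have -> : maxn i.+1 j = j by lia.
  have -> : maxn i j = j by lia.
  have -> : maxn i.+2 j = j by lia.
  by rewrite -!natr1; field.
- rewrite gtn_eqF //= mulr0n; have -> : minn i.+1 j = j by lia.
  have -> : minn i j = j by lia.
  have -> : minn i.+2 j = j by lia.
  have -> : maxn i.+1 j = i.+1 by lia.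
  have -> : maxn i j = i by lia.
  have -> : maxn i.+2 j = i.+2 by lia.
  rewrite !natrB; try lia.
  by rewrite -!natr1; field.
- rewrite eq eqxx /= mulr1n; have -> : minn j j = i.+1 by lia.
  have -> : minn i j = i by lia.
  have -> : minn j.+1 j = i.+1 by lia.
  have -> : maxn j j = i.+1 by lia.
  have -> : maxn i j = i.+1 by lia.
  have -> : maxn j.+1 j = i.+2 by lia.
  rewrite !natrB; try lia.
  by rewrite -!natr1; field.
Qed.

Section CartanInverse.
Variable k : nat.
Let N := k.+1.
Local Notation gr := (green k.+1).

Lemma cartanA_mul (G : nat -> rat) (v : 'cV[rat]_k) (i : 'I_k) :
  G 0%N = 0 -> G N = 0 -> (forall j : 'I_k, v j 0 = G j.+1) ->
  (cartanA k *m v) i 0 = 2 * G i.+1 - G i - G i.+2.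
Proof.
move=> G0 GN vG; rewrite mxE -addrA -opprD -(sum_neighbours i G0 GN).
rewrite (eq_bigr (fun j : 'I_k => (i == j)%:R * (2 * G j.+1) -
    (`|i%:Z - j%:Z|%N == 1%N)%:R * G j.+1)) => [|j _]; last first.
  by rewrite !mxE vG mulrBl mulrA.
rewrite sumrB; congr (_ - _).
rewrite (bigD1 i) //= eqxx mul1r big1 ?addr0 // => j /negPf.
by rewrite eq_sym => ->; rewrite mul0r.
Qed.

Lemma cartanA_green : cartanA k *m (\matrix_(i, j) gr i.+1 j.+1) = 1%:M.
Proof.
apply/matrixP => i j; rewrite [RHS]mxE.
set X := \matrix_(i, j) _; transitivity ((cartanA k *m col j X) i 0).
  by rewrite !mxE; apply: eq_bigr => h _; rewrite !mxE.
have lt_jk := ltn_ord j; have lt_ik := ltn_ord i.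
rewrite (@cartanA_mul (fun i => gr i j.+1)).
- by rewrite green_diff2.
- by rewrite /green min0n !mul0r.
- rewrite /green; have -> : (N - maxn N j.+1 = 0)%N by lia.
  by rewrite mulr0 mul0r.
- by move=> i'; rewrite !mxE.
Qed.

Lemma invmx_cartanA : invmx (cartanA k) = \matrix_(i, j) gr i.+1 j.+1.
Proof.
have [uC _] := mulmx1_unit cartanA_green.
by rewrite -[RHS]mul1mx -(mulVmx uC) -mulmxA cartanA_green mulmx1.
Qed.

Lemma invmx_cartanA_sym : (invmx (cartanA k))^T = invmx (cartanA k).
Proof.
by rewrite invmx_cartanA; apply/matrixP => i j; rewrite !mxE /green minnC maxnC.
Qed.

Lemma invmx_cartanA_coord1 (n : 'cV[nat]_k) :
  coord1 (invmx (cartanA k) *m ratv n) 1 =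
  (\sum_(i < k) ((k - i) * n i 0%R)%N)%:R / k.+1%:R.
Proof.
rewrite /coord1 invmx_cartanA; case: k n => [|k'] n.
  by rewrite !big_ord0 mul0r.
rewrite (big_pred1 ord0) // mxE natr_sum mulr_suml; apply: eq_bigr => j _.
rewrite !mxE /green natrM.
have -> : minn 1 j.+1 = 1%N by lia.
have -> : maxn 1 j.+1 = j.+1 by lia.
by rewrite subSS mul1r mulrAC.
Qed.

Lemma bilinBl (v v' w : 'cV[rat]_k) M : bilin (v - v') M w = bilin v M w - bilin v' M w.
Proof. by rewrite /bilin linearB /= !mulmxBl !mxE. Qed.

Lemma bilinBr (v w w' : 'cV[rat]_k) M : bilin v M (w - w') = bilin v M w - bilin v M w'.
Proof. by rewrite /bilin mulmxBr !mxE. Qed.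

Lemma bilinZl c (v w : 'cV[rat]_k) M : bilin (c *: v) M w = c * bilin v M w.
Proof. by rewrite /bilin linearZ /= -!scalemxAl !mxE. Qed.

Lemma bilinZr c (v w : 'cV[rat]_k) M : bilin v M (c *: w) = c * bilin v M w.
Proof. by rewrite /bilin -scalemxAr !mxE. Qed.

Lemma bilin_unitv (l : nat) : (l <= k)%N ->
  bilin (unitv rat k l) (invmx (cartanA k)) (unitv rat k l) =
  l%:R * (N%:R - l%:R) / N%:R.
Proof.
move=> lk; rewrite bilinE invmx_cartanA; case: l lk => [|l] lk.
  by rewrite big1 ?mul0r // => i _; rewrite mxE mul0r.
rewrite (bigD1 (Ordinal lk)) //= big1 ?addr0 => [|i /eqP il]; last first.
  rewrite mxE eqSS; case: eqP => [e|_]; last by rewrite mul0r.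
  by case: il; apply: val_inj.
rewrite !mxE eqxx mul1r (bigD1 (Ordinal lk)) //= big1 ?addr0 => [|i /eqP il]; last first.
  rewrite !mxE eqSS; case: eqP => [e|_]; last by rewrite mulr0.
  by case: il; apply: val_inj.
by rewrite !mxE eqxx mulr1 /green minnn maxnn natrB // ltnW.
Qed.

End CartanInverse.

(** * Energy and end point of a height path *)

Section HeightExponent.
Variables (k l : nat).
Hypothesis lk : (l <= k)%N.
Let N := k.+1.
Let d (i : nat) : int := (i == l)%:Z.
Variables (c a : int) (n : 'cV[nat]_k).
Hypothesis ha : height d c n k.+1 = a.

Let F (j : nat) : rat := (height d c n j)%:~R.
Let f : 'cV[rat]_k := unitv rat k l - 2 *: ratv n.

Lemma height_diff2 (i : 'I_k) : 2 * F i.+1 - F i - F i.+2 = f i 0.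
Proof.
rewrite /F height_rec ext_ord !mxE /d !(rmorphB, rmorphD, rmorphM) /=; ring.
Qed.

(** Subtracting the straight line a j / N leaves a path W with zero ends and second differences f =
    e_l - 2 n, so W = C^{-1} f. The line contributes a^2 / (4 N), the rest f^T C^{-1} f / 4, whose
    expansion gives the other two terms. *)
Lemma sqlen_height : sqlen k (height d c n) =
  a%:~R ^+ 2 / (4 * N%:R) + l%:R * (N%:R - l%:R) / (4 * N%:R) +
  bilin (ratv n) (invmx (cartanA k)) (ratv n - unitv rat k l).
Proof.
have N0 : N%:R != 0 :> rat by rewrite pnatr_eq0.
have FN : F N = a%:~R by rewrite /F ha.
pose W j := F j - a%:~R * j%:R / N%:R.
have W0 : W 0%N = 0 by rewrite /W /F height0 mulr0 mul0r subr0.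
have WN : W N = 0 by rewrite /W FN mulfK // subrr.
have W2 (i : 'I_k) : 2 * W i.+1 - W i - W i.+2 = f i 0.
  by rewrite -height_diff2 /W; move: (N%:R^-1) => iN; rewrite -!natr1; ring.
have wE : \col_(i < k) W i.+1 = invmx (cartanA k) *m f.
  have [uC _] := mulmx1_unit (cartanA_green k).
  rewrite -[LHS](mulKmx uC); congr (_ *m _); apply/colP => i.
  rewrite (cartanA_mul i W0 WN) ?W2 // => j; by rewrite mxE.
have sumf : \sum_(i < k) i.+1%:R * f i 0 = N%:R * F k - a%:~R * k%:R.
  under eq_bigr do rewrite -W2.
  by rewrite sum_index_diff2 // WN mulr0 subr0 /W -/N mulrBr [N%:R * (_ / _)]mulrC mulfVK.
have sumW : \sum_(i < k) W i.+1 * f i 0 = bilin f (invmx (cartanA k)) f.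
  by rewrite bilinE -wE; apply: eq_bigr => i _; rewrite [RHS]mulrC; congr (_ * _); rewrite mxE.
have sumF : \sum_(i < k) F i.+1 * f i 0 =
    bilin f (invmx (cartanA k)) f + a%:~R / N%:R * (N%:R * F k - a%:~R * k%:R).
  rewrite -sumW -sumf mulr_sumr -big_split; apply: eq_bigr => i _ /=.
  by rewrite /W; move: (N%:R^-1) => iN; ring.
have sq : \sum_(i < k) (F i - F i.+1) ^+ 2 = \sum_(i < k) F i.+1 * f i 0 - F k * (F k - a%:~R).
  under [X in _ = X - _]eq_bigr do rewrite -height_diff2.
  by rewrite sum_mul_diff2 ?FN ?addrK // /F height0.
have -> : sqlen k (height d c n) = (\sum_(i < k.+1) (F i - F i.+1) ^+ 2) / 4.
  rewrite /sqlen rmorph_sum /=; congr (_ / _); apply: eq_bigr => i _.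
  by rewrite rmorphXn rmorphB.
rewrite big_ord_recr /= -/N FN sq sumF /f.
rewrite !(bilinBl, bilinBr, bilinZl, bilinZr) bilin_unitv //.
rewrite (bilin_sym (unitv rat k l)) ?invmx_cartanA_sym //.
move: (bilin _ _ _) (bilin _ _ _) => u v.
have -> : N%:R = k%:R + 1 :> rat by rewrite natr1.
by field; rewrite natr1.
Qed.

(** Pairing the second differences with the weights k - i gives N c - a; the term in l is N (C^{-1}
    e_l)_1, which is 0 for l = 0. *)
Lemma height_top : a = N%:Z * c - (if (0 < l)%N then (N - l)%:Z else 0) +
  2 * (\sum_(i < k) ((k - i) * n i 0%R)%N)%:Z.
Proof.
have := @sum_coindex_diff2 _ (height d c n) (height0 d c n) k.
rewrite ha height1.
have -> : \sum_(i < k) (k - i)%:R * (2 * height d c n i.+1 - height d c n i - height d c n i.+2) =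
    \sum_(i < k) (k - i)%:Z * d i.+1 - 2 * (\sum_(i < k) ((k - i) * n i 0%R)%N)%:Z.
  rewrite (big_morph Posz PoszD (erefl _)) mulr_sumr -sumrB; apply: eq_bigr => i _.
  by rewrite height_rec ext_ord PoszM; move: (height d c n i.+1) (height d c n i); lia.
have -> : \sum_(i < k) (k - i)%:Z * d i.+1 = if (0 < l)%N then (N - l)%:Z else 0.
  rewrite /d; case: l lk => [|l'] lk' /=; first by apply: big1 => i _; rewrite mulr0.
  rewrite (bigD1 (Ordinal lk')) //= eqxx mulr1 big1 ?addr0 ?subSS // => i /eqP il.
  by rewrite eqSS; case: eqP => [e|_]; rewrite ?mulr0 //; case: il; apply: val_inj.
rewrite natz -/N; lia.
Qed.

End HeightExponent.

Lemma intr_div_nat (x : int) (D : nat) : (0 < D)%N ->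
  ((x%:~R / D%:R : rat) \is a Num.int) <-> exists t, x = D%:Z * t.
Proof.
move=> D0; have nzD : D%:R != 0 :> rat by rewrite pnatr_eq0; lia.
split=> [/intrP[t xt]|[t ->]]; last by rewrite rmorphM /= mulrAC divff ?mul1r.
exists t; apply: (@intr_inj rat); rewrite rmorphM /= -xt mulrC mulfVK //.
Qed.

(** * String functions as parafermionic sums *)

Section StringFunction.
Variables (k l r : nat).
Hypothesis lk : (l <= k)%N.
Let N := k.+1.
Let d (i : nat) : int := (i == l)%:Z.
(** The coordinate Q_1: e_1 occurs among e_(l+1), e_(l+3), ... exactly when l = 0, and r + 1 times
    in the second part of Q. *)
Let tau : int := ((l == 0) + r.+1)%N.
Let d01 i : 0 <= d i <= 1. Proof. by rewrite /d; case: eqP. Qed.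

Definition string_index (M : int) : set 'cV[nat]_k := [set n |
  (M + l%:Z)%:~R / (2 * N%:R) + coord1 (invmx (cartanA k) *m ratv n) 1 \is a Num.int].

Definition string_term (n : 'cV[nat]_k) : lser :=
  lq (bilin (ratv n) (invmx (cartanA k)) (ratv n - unitv rat k l)) *
  \prod_(i < k) hpoch (n i 0%R).

Definition string_sum (M : int) : lser :=
  lsum (fun n => if n \in string_index M then string_term n else 0).

(** By [height_top], -a + N r + l + 2 s equals N (r + e - c), with e = 1 for l > 0 and e = 0
    otherwise. Divisibility by 2 N thus means that an integral slope c exists and has the parity of
    r + e, that is, of [tau]. *)
Lemma string_index_admissible a M t n : M = - a + N%:Z * r%:Z + 2 * N%:Z * t ->
  string_index M n <-> admissible d tau a n.
Proof.
move=> Ma; pose s : int := (\sum_(i < k) ((k - i) * n i 0%R)%N)%:Z.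
pose e : int := (0 < l)%N%:Z.
have top c : height d c n k.+1 = N%:Z * c - N%:Z * e + l%:Z + 2 * s.
  rewrite (@height_top k l lk c _ n erefl) -/s /e /N.
  by case: ltnP => l0 /=; lia.
have -> : string_index M n <-> exists h, - a + N%:Z * r%:Z + l%:Z + 2 * s = (2 * N)%N%:Z * h.
  rewrite /string_index /= invmx_cartanA_coord1.
  have -> : (M + l%:Z)%:~R / (2 * N%:R) + (\sum_(i < k) ((k - i) * n i 0%R)%N)%:R / k.+1%:R =
     (M + l%:Z + 2 * s)%:~R / (2 * N)%N%:R :> rat.
    rewrite /s [in RHS]rmorphD [in RHS]rmorphM /= -pmulrn natrM -/N.
    have N0 : N%:R != 0 :> rat by rewrite pnatr_eq0.
    by field.
  rewrite intr_div_nat //; split=> -[h hE].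
    by exists (h - t); rewrite mulrBr -hE Ma /N; lia.
  by exists (h + t); rewrite mulrDr -hE Ma /N; lia.
have tauE : tau = r%:Z + 2 - e by rewrite /tau /e; case: (l) => [|l'] /=; lia.
split=> [[h hE]|[ha par]].
  have hc : height d (r%:Z + e - 2 * h) n k.+1 = a by rewrite top; lia.
  have sc := slope_uniq hc.
  by split; rewrite sc // tauE; lia.
move: ha; rewrite top; set c := slope d a n in par * => ha.
pose h := ((r%:Z + e - c) %/ 2)%Z; have cE : c = r%:Z + e - 2 * h.
  by rewrite /h; move: par; rewrite tauE; lia.
by exists h; move: ha; rewrite cE; lia.
Qed.

Lemma paraf_string a M t : M = - a + N%:Z * r%:Z + 2 * N%:Z * t ->
  paraf d tau k a =
  lq (a%:~R ^+ 2 / (4 * N%:R) + l%:R * (N%:R - l%:R) / (4 * N%:R)) * string_sum M /\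
  summable (fun n => if n \in string_index M then string_term n else 0).
Proof.
move=> Ma; set C := _ + _ : rat.
have E n : (if `[< admissible d tau a n >] then
    lq (sqlen k (height d (slope d a n) n)) * \prod_(i < k) hpoch (n i 0%R) else 0) =
  lq C * (if n \in string_index M then string_term n else 0).
  have := string_index_admissible n Ma.
  case: (pselect (admissible d tau a n)) => [ad|nad] iff; last first.
    rewrite asboolF // ifN ?mulr0 //; apply/negP; rewrite in_setE.
    by move=> /iff.
  rewrite asboolT // ifT; last by rewrite in_setE; apply/iff.
  by rewrite (sqlen_height lk ad.1) lqD -mulrA.
have sS : summable (fun n => if n \in string_index M then string_term n else 0).
  have -> : (fun n => if n \in string_index M then string_term n else 0) =
    (fun n => lq (- C) * (if `[< admissible d tau a n >] then
    lq (sqlen k (height d (slope d a n) n)) * \prod_(i < k) hpoch (n i 0%R) else 0)).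
    by apply/funext => n; rewrite E mulrA -lqD addNr lq0 mul1r.
  by apply: summableMl; exact: summable_paraf.
by split=> //; rewrite /paraf (eq_lsum E) lsumMl.
Qed.

Lemma string_funE (M : int) :
  summable (fun n => if n \in string_index M then string_term n else 0) ->
  string_fun N l M = lq (string_exp N l) * hpoch_infty * string_sum M.
Proof.
move=> sS; rewrite !lmulE /string_fun -(qinv_linv ordge_1sub_lpoch_infty).
rewrite /string_sum -qsumE //.
suff -> : (fun n : 'cV[nat]_k => 'q^(bilin (ratv n) (invmx (cartanA k))
    (ratv n - unitv rat k l)) **
    qinv (\big[qmul/'q^(0)]_(i < k) qpoch (n i 0))) =
  (fun n => string_term n : qseries) by [].
apply/funext => n.
rewrite /string_term lmulE; congr (_ ** _).
under eq_bigr do rewrite qpochE.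
rewrite -lprodE; apply: qinvE.
  apply: (big_ind (fun f : lser => ordge 1 (1 - f))).
  - by rewrite subrr; exact: ordge0.
  - by move=> f g; exact: ordge_1subM.
  - by move=> i _; exact: ordge_1sub_lpoch.
by rewrite -big_split big1 // => i _; exact: mul_hpoch.
Qed.

End StringFunction.

(** * The fermionic exponent and binomials along a chain *)

Lemma ext_lt k x (m : 'cV[nat]_k) y j (jk : (j < k)%N) :
  ext x m y j.+1 = m (Ordinal jk) 0.
Proof. exact: (ext_ord x m y (Ordinal jk)). Qed.

Lemma ext_indep k x (m : 'cV[nat]_k) y y' j : (j <= k)%N ->
  ext x m y j = ext x m y' j.
Proof. by case: j => // j jk; rewrite !(ext_lt _ _ _ jk). Qed.

Lemma qbinom_hbin (z : int) (c : nat) : 0 <= z ->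
  qbinom (z%:~R / 2) c%:R = hbin z c.
Proof.
case: z => // z _; rewrite qbinomE /= natr_nat andbT.
case: (boolP (odd z)) => zodd.
  rewrite ifF //; apply/negbTE/negP => /natrP[m].
  move=> /(congr1 (fun x => x * 2)); rewrite mulrBl mulfVK // -pmulrn -!natrM.
  by move/eqP; rewrite subr_eq -natrD eqr_nat => /eqP; lia.
have -> : (Posz z)%:~R / 2 = z./2%:R :> rat.
  by rewrite -[in LHS](odd_double_half z) (negPf zodd) add0n -muln2 PoszM rmorphM /= mulfK.
rewrite !natrK; case: (leqP c z./2) => [cz|zc]; first by rewrite -natrB // natr_nat.
by rewrite gbin_gt //; case: ifP.
Qed.

Section Columns.
Variable k : nat.
Let N := k.+1.
Let H (m : 'cV[nat]_N) (j : nat) : int := ext 0 m 0 j.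

Lemma coord1_ext (R : pzSemiRingType) (v : 'cV[R]_N) j (jN : (j < N)%N) :
  coord1 v j.+1 = v (Ordinal jN) 0.
Proof.
by rewrite /coord1 (big_pred1 (Ordinal jN)).
Qed.

Lemma coord1_ratv (m : 'cV[nat]_N) j : (0 < j <= N)%N -> coord1 (ratv m) j = (H m j)%:~R.
Proof.
case: j => // j jN; have {}jN : (j < N)%N := jN.
rewrite (coord1_ext _ jN) mxE /H (ext_lt _ _ _ jN).
by rewrite pmulrn.
Qed.

(** The loop of the tadpole is a reflecting end: repeating m_N at position N + 1 makes T m a second
    difference everywhere, and the repeated value adds a step of length 0. At the other end m_0 =
    0. *)
Lemma bilin_cartanT (m : 'cV[nat]_N) :
  4^-1 * bilin (ratv m) (cartanT N) (ratv m) = sqlen k (H m).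
Proof.
pose G i : rat := (ext 0 m (m ord_max 0)%:Z i)%:~R.
have G0 : G 0%N = 0 by [].
have GE (i : 'I_N) : ratv m i 0 = G i.+1 by rewrite mxE /G ext_ord pmulrn.
have GN : G N.+1 = G N.
  by rewrite /G ext_last (ext_ord 0 m _ (ord_max : 'I_N)).
have mulT (i : 'I_N) : (cartanT N *m ratv m) i 0 = 2 * G i.+1 - G i - G i.+2.
  pose G' j : rat := if (j <= N)%N then G j else 0.
  have G'0 : G' 0%N = 0 by [].
  have G'N : G' N.+1 = 0 by rewrite /G' ltnn.
  have sumE := sum_neighbours i G'0 G'N.
  have lt_iN := ltn_ord i.
  rewrite mxE (eq_bigr (fun j : 'I_N => (i == j)%:R * (2 * G j.+1 - (j.+1 == N)%:R * G j.+1) -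
    (`|i%:Z - j%:Z|%N == 1%N)%:R * G' j.+1)); last first.
    move=> j _; rewrite GE !mxE /G' ltn_ord; case: eqP => [->|_] /=; ring.
  rewrite sumrB sumE (bigD1 i) //= eqxx mul1r big1 ?addr0 => [|j /negPf]; last first.
    by rewrite eq_sym => ->; rewrite mul0r.
  rewrite /G' (ltnW lt_iN); case: (ltnP i.+1 N) => [lt|ge].
    have -> : (i.+1 == N :> nat) = false by lia.
    by rewrite mul0r subr0; ring.
  have eqN : i.+1 = N by lia.
  by rewrite eqN eqxx GN mul1r; ring.
rewrite bilinE (eq_bigr (fun i : 'I_N => G i.+1 * (2 * G i.+1 - G i - G i.+2))).
  rewrite (sum_mul_diff2 G0) GN subrr mulr0 addr0 /sqlen mulrC rmorph_sum; congr (_ / _).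
  apply: eq_bigr => i _; rewrite rmorphXn rmorphB /G /H; have iN := ltn_ord i.
  by rewrite !(ext_indep 0 m (m ord_max 0) 0) // ltnW.
by move=> i _; rewrite GE mulT.
Qed.

Lemma coord1_nvec l (m : 'cV[nat]_N) j : (0 < j < N)%N ->
  coord1 (ratv m) j + coord1 (nvec l m) j = (H m j.-1 + H m j.+1 + (j == l)%:Z)%:~R / 2.
Proof.
case: j => // j jN; have {}jN : (j.+1 < N)%N := jN.
have jN' := ltnW jN.
rewrite !(coord1_ext _ jN') !mxE.
pose G i : rat := if (i <= N)%N then (H m i)%:~R else 0.
have G0 : G 0%N = 0 by [].
have GN : G N.+1 = 0 by rewrite /G ltnn.
have Gj : G (Ordinal jN') = (H m j)%:~R by rewrite /G ifT // ltnW.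
have Gj2 : G (Ordinal jN').+2 = (H m j.+2)%:~R by rewrite /G ifT.
have sumE := sum_neighbours (Ordinal jN') G0 GN.
have -> : \sum_(i < N) incT N (Ordinal jN') i * ratv m i 0 = (H m j)%:~R + (H m j.+2)%:~R.
  rewrite -Gj -Gj2 -sumE; apply: eq_bigr => i _.
  rewrite !mxE /G ltn_ord /H (ext_ord 0 m 0 i) -pmulrn.
  congr (_ * _); rewrite -[RHS]addr0; congr (_ + _).
  case: eqP => [<-|_] //=; have -> : (j.+1 == N) = false by lia.
  by [].
by rewrite !rmorphD /= -!pmulrn; field.
Qed.

End Columns.

(** * The parity vector Q *)

Definition parity (l r j : nat) : nat :=
  (((l < j) && odd (j - l)) + r.+1 * odd j)%N.

(** The condition for the upper entry of the binomial at vertex j + 1 to be integral; it determines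
    Q modulo 2 from Q_0 and Q_1. *)
Lemma parity_rec l r j : ~~ odd (parity l r j + parity l r j.+2 + (j.+1 == l))%N.
Proof.
rewrite /parity /= negbK; move: (r.+1 * odd j)%N => t.
have -> : (((l < j) && odd (j - l)) + t + (((l < j.+2) && odd (j.+2 - l)) + t) + (j.+1 == l) =
   ((((l < j) && odd (j - l)) + ((l < j.+2) && odd (j.+2 - l)) + (j.+1 == l)) + t.*2))%N.
  by rewrite -addnn; lia.
rewrite oddD odd_double addbF.
have [lj|[jl|[jl|jl]]] : (l < j \/ l = j \/ l = j.+1 \/ j.+1 < l)%N by lia.
- have -> : (j.+2 - l = (j - l).+2)%N by lia.
  rewrite /= negbK lj; have -> : (l < j.+2)%N by lia.
  have -> : (j.+1 == l) = false by lia.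
  by case: (odd (j - l)).
- subst l; rewrite ltnn /=; have -> : (j.+2 - j = 2)%N by lia.
  have -> : (j.+1 == j) = false by lia.
  by rewrite /= andbF.
- subst l; rewrite eqxx; have -> : (j.+2 - j.+1 = 1)%N by lia.
  have -> : (j.+1 < j)%N = false by lia.
  by have -> : (j.+1 < j.+2)%N by lia.
- have -> : (l < j)%N = false by lia.
  have -> : (l < j.+2)%N = false by lia.
  by have -> : (j.+1 == l) = false by lia.
Qed.

Lemma parityQE N l r (i : 'I_N) : parityQ N l r i 0 = parity l r i.+1.
Proof.
have sumE c : \sum_(t < N) unitv nat N (c + 1 + t.*2)%N i 0 =
    ((c < i.+1)%N && odd (i.+1 - c))%N :> nat.
  have lt_iN := ltn_ord i.
  under eq_bigr do rewrite mxE.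
  case: (boolP ((c < i.+1)%N && odd (i.+1 - c))) => [/andP[ci od]|no].
    (* The only t with c + 1 + 2 t = i + 1. *)
    have tN : ((i - c)./2 < N)%N by lia.
    rewrite (bigD1 (Ordinal tN)) //= big1 => [|t /eqP ne].
      by have -> : (i.+1 == (c + 1 + (i - c)./2.*2)%N) by lia.
    case: eqP => // e; case: ne; apply: val_inj => /=; lia.
  by apply: big1 => t _; case: eqP => // e; move: no; rewrite e; lia.
rewrite /parityQ mxE summxE sumE mulmxnE summxE.
have := sumE 0%N; under eq_bigr do rewrite add0n.
move=> ->; rewrite subn0 -mulr_natr natn /parity.
by congr (_ + _)%N; exact: mulnC.
Qed.

Lemma qbinom_bkernel (L : nat) (a : int) (c : rat) : c = (L%:Z - a)%:~R / 2 ->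
  qbinom L%:R c = lpoch L * bkernel L a.
Proof.
move=> cE; rewrite qbinomE; case: ifPn => [/andP[/natrP[v vE] /natrP[u uE]]|no].
  have LE : L = (u + v)%N.
    by apply/eqP; rewrite -(eqr_nat rat) natrD -uE -vE addrC subrK.
  have aE : a = v%:Z - u%:Z.
    apply: (@intr_inj rat); rewrite rmorphB /= -!pmulrn -vE -uE.
    by rewrite cE rmorphB /= -pmulrn; field.
  rewrite uE !natrK LE gbin_fact /bkernel.
  by rewrite (hhalfE (n := u)) ?(hhalfE (n := v)) -?mulrA //; lia.
case: (eqVneq (bkernel L a) 0) => [->|/eqP /bkernel_neq0[u [v [uE vE]]]].
  by rewrite mulr0.
case/negP: no; have cu : c = u%:R.
  by rewrite cE uE rmorphM /= -pmulrn mulrAC divff ?mul1r.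
have -> : L%:R - c = v%:R :> rat.
  have LE : L = (u + v)%N by lia.
  by rewrite cu LE natrD addrC addKr.
by rewrite cu !natr_nat.
Qed.

(** * The fermionic sum *)

Section FermionicSide.
Variables (k l r : nat).
Let N := k.+1.
Let d (i : nat) : int := (i == l)%:Z.
Let tau : int := ((l == 0) + r.+1)%N.
Let d01 i : 0 <= d i <= 1. Proof. by rewrite /d; case: eqP. Qed.
Let H (m : 'cV[nat]_N) (j : nat) : int := ext 0 m 0 j.

Definition fermionic_index : set 'cV[nat]_N :=
  [set m | forall i, m i 0 = parityQ N l r i 0 %[mod 2]].

(** The congruence m = Q modulo 2 is forced by nonzero weight: [tau] fixes the parity of m_1, and
    integral upper entries propagate it by [parity_rec]. The restricted sum is thus a sum over all
    m. *)
Lemma cweight_neq0 m : cweight d tau k (H m) <> 0 -> fermionic_index m.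
Proof.
move=> cw0; have par : ((H m 0%N + H m 1%N + tau) %% 2 = 0)%Z.
  apply/eqP; apply: contra_notT cw0 => /negPf par.
  by rewrite /cweight par !mul0r.
have hM (i : 'I_k) : hbin (H m i + H m i.+2 + d i.+1) (H m i.+1) <> 0.
  move=> hM; apply: cw0; rewrite /cweight (bigD1 i) //= hM.
  by rewrite mul0r mulr0.
have HQ j : (j <= N)%N -> ((H m j - (parity l r j)%:Z) %% 2 = 0)%Z.
  elim/ind2: j => [||j IH IHS] jN; first by rewrite /H /= /parity ltn0 /= muln0.
    move: par; rewrite /tau /parity muln1 {1}/H /=.
    by case: (l) => [|l'] /=; rewrite ?subn0 /=; lia.
  have jk : (j < k)%N by lia.
  have [p [q [zE _]]] := hbin_neq0 (hM (Ordinal jk)).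
  have {}zE : H m j + H m j.+2 + d j.+1 = 2 * (p + q)%:Z := zE.
  have := parity_rec l r j; have := IH (ltnW (ltnW jN)).
  by move: zE; rewrite /d; lia.
move=> i; rewrite parityQE; have := HQ i.+1 (ltn_ord i).
rewrite /H (ext_ord 0 m 0 i); lia.
Qed.

Lemma fermionic_term m :
  (if m \in fermionic_index then lq (4^-1 * bilin (ratv m) (cartanT N) (ratv m)) *
     \prod_(1 <= j < N) hbin (H m j.-1 + H m j.+1 + d j) (H m j) else 0) =
  cweight d tau k (H m).
Proof.
case: (boolP (m \in fermionic_index)) => [|nA]; last first.
  apply: esym; apply: contrapT => cw0; move: nA; rewrite notin_setE => nA.
  exact: nA (cweight_neq0 cw0).
rewrite in_setE => mA; rewrite bilin_cartanT /cweight prod_qsq.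
have -> : ((H m 0%N + H m 1%N + tau) %% 2 == 0)%Z.
  have := mA ord0; rewrite parityQE /parity muln1 /tau.
  have -> : H m 0%N = 0 by [].
  have -> : H m 1%N = m ord0 0 by rewrite /H (ext_ord 0 m 0 (ord0 : 'I_N)).
  by case: (l) => [|l'] /=; lia.
by rewrite mul1r big_add1 big_mkord.
Qed.

Arguments ext : simpl never.

(** Here the end of the chain is the entry m_N itself; a repeated last vertex costs no energy, so
    the finiteness of chains with prescribed ends applies. *)
Lemma sqlen_last (m : 'cV[nat]_N) :
  sqlen N (ext 0 m (m ord_max 0%R)%:Z) = sqlen k (H m).
Proof.
rewrite /sqlen big_ord_recr /= (ext_last 0 m) (ext_ord 0 m _ (ord_max : 'I_N)).
rewrite subrr expr0n addr0; congr (_%:~R / _); apply: eq_bigr => i _.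
by have iN := ltn_ord i; rewrite !(ext_indep 0 m (m ord_max 0%R) 0) // ltnW.
Qed.

Lemma finite_sqlen_last e : finite_set [set m | sqlen k (H m) < e].
Proof.
apply: sub_finite_set (finite_sqlen 0 (fun m : 'cV[nat]_N => (m ord_max 0%R)%:Z) e).
by move=> m /=; rewrite sqlen_last.
Qed.

Lemma summable_fermionic (c : 'cV[nat]_N -> lser) : (forall m, ordge 0 (c m)) ->
  summable (fun m => cweight d tau k (H m) * c m).
Proof.
move=> c0; apply: summable_ge finite_sqlen_last _ => m.
exact/ordgeMl/c0/ordge_cweight.
Qed.

(** Splitting off L = m_N leaves the chains from 0 to L, hence the left side of [spinon]. *)
Lemma lsum_fermionic a :
  lsum (fun m => cweight d tau k (H m) * bkernel (m ord_max 0%R) a) =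
  hpoch_infty * paraf d tau k a.
Proof.
have d0 i : 0 <= d i by case/andP: (d01 i).
rewrite -spinon // lsum_nat_int; last 2 first.
- exact: summable_bkernel.
- move=> t t0; rewrite (_ : bkernel t a = 0) ?mul0r //.
  by apply: contrapT => /bkernel_neq0[p [q [pE qE]]]; lia.
have sH := @summable_fermionic (fun m => bkernel (m ord_max 0%R) a)
  (fun m => ordge_bkernel _ _).
have E (u : nat) (m : 'cV[nat]_k) : cweight d tau k (H (rcons_cv (u, m))) *
    bkernel (rcons_cv (u, m) ord_max 0%R) a =
    bkernel u a * cweight d tau k (ext 0 m u).
  rewrite (@eq_cweight d tau k (H (rcons_cv (u, m))) (ext 0 m u)); last first.
    by move=> j jk; rewrite /H ext_rcons.
  have -> : rcons_cv (u, m) ord_max 0 = u.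
    by have := congr1 fst (rcons_cvK (u, m)).
  by rewrite mulrC.
rewrite (lsum_reindex_bij sH (rcons_cv_bij k)).
have sE : summable (fun p : nat * 'cV[nat]_k =>
    bkernel p.1 a * cweight d tau k (ext 0 p.2 p.1)).
  have := summable_comp (bij_inj (rcons_cv_bij k)) sH.
  by apply: summable_dom => -[u m] e; rewrite E.
rewrite (eq_lsum (G := fun p : nat * 'cV[nat]_k =>
    bkernel p.1 a * cweight d tau k (ext 0 p.2 p.1))); last by move=> [u m]; exact: E.
rewrite (lsum_pair (F := fun (u : nat) (m : 'cV[nat]_k) =>
    bkernel u a * cweight d tau k (ext 0 m u))) //.
apply: eq_lsum => u; rewrite lsumMl ?chainsumE //.
have := @summable_cweight d tau k 0 (fun=> u%:Z) (fun=> 1) (fun=> ordge1).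
by under eq_fun do rewrite mulr1.
Qed.

Lemma finite_sqlen_abs e :
  finite_set [set p : 'cV[nat]_N * int | sqlen k (H p.1) + `|p.2|%:~R < e].
Proof.
apply: sub_finite_set (finite_setX (finite_sqlen_last e) (finite_int_abs e)).
move=> [m z] /= mz; have := sqlen_ge0 k (H m).
have : 0 <= `|z|%:~R :> rat by rewrite ler0z.
by split => /=; lra.
Qed.

Section Bosonic.
Variables (e1 e2 a1 a2 : int -> int).
Hypotheses (e1P : forall z, `|z| <= e1 z) (e2P : forall z, `|z| <= e2 z).

Definition bosonic (L z : int) : lser :=
  lq (e1 z)%:~R * bkernel L (a1 z) - lq (e2 z)%:~R * bkernel L (a2 z).

Lemma summable_lq_abs (e : int -> int) (f : int -> lser) :
  (forall z, `|z| <= e z) -> (forall z, ordge 0 (f z)) ->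
  summable (fun z => lq (e z)%:~R * f z).
Proof.
move=> eP f0; apply: summable_ge finite_int_abs _ => z; apply: ordgeMl => //.
by apply: ordgeW (ordge_lq _); rewrite ler_int.
Qed.

Lemma summable_bosonic L : summable (bosonic L).
Proof. by apply: summableB; apply: summable_lq_abs => // z; exact: ordge_bkernel. Qed.

(** The exchange of the sums over m and j: the double family has order at least the energy of m plus
    |z|, so it is summable. *)
Lemma lsum_fermionic_bosonic :
  lsum (fun m => cweight d tau k (H m) * lsum (bosonic (m ord_max 0%R))) =
  hpoch_infty * (lsum (fun z => lq (e1 z)%:~R * paraf d tau k (a1 z)) -
                 lsum (fun z => lq (e2 z)%:~R * paraf d tau k (a2 z))).
Proof.
have p0 a := ordge_paraf d tau k a.
transitivity (lsum (fun m => lsum (fun z =>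
    cweight d tau k (H m) * bosonic (m ord_max 0%R) z))).
  by apply: eq_lsum => m; rewrite lsumMl //; exact: summable_bosonic.
rewrite (lsum_swap (F := fun m z => cweight d tau k (H m) * bosonic (m ord_max 0%R) z)).
  rewrite -lsumB; try exact: summable_lq_abs.
  rewrite -lsumMl; last by apply: summableB; exact: summable_lq_abs.
  apply: eq_lsum => z.
  transitivity (lsum (fun m => lq (e1 z)%:~R * (cweight d tau k (H m) * bkernel (m ord_max 0%R) (a1 z)) -
     lq (e2 z)%:~R * (cweight d tau k (H m) * bkernel (m ord_max 0%R) (a2 z)))).
    apply: eq_lsum => m; rewrite /bosonic.
    move: (cweight _ _ _ _) (lq _) (lq _) (bkernel _ _) (bkernel _ _) => x1 x2 x3 x4 x5.
    by ring.
  have sH a := @summable_fermionic (fun m => bkernel (m ord_max 0%R) a)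
    (fun m => ordge_bkernel _ _).
  rewrite lsumB; try exact/summableMl/sH.
  rewrite (lsumMl _ (sH (a1 z))) (lsumMl _ (sH (a2 z))).
  rewrite !lsum_fermionic.
  move: (paraf _ _ _ _) (paraf _ _ _ _) (lq _) (lq _) => x1 x2 x3 x4.
  by ring.
apply: summable_ge finite_sqlen_abs _ => -[m z] /=.
apply: ordgeM; first exact: ordge_cweight.
apply: ordgeB; apply: ordgeMl (ordge_bkernel _ _).
- by apply: ordgeW (ordge_lq _); rewrite ler_int.
- by apply: ordgeW (ordge_lq _); rewrite ler_int.
Qed.

End Bosonic.
End FermionicSide.

Lemma lsubE (f g : lser) : (f - g : lser) = f \- g :> qseries.
Proof. by apply/funext => x; rewrite laddE loppE. Qed.

Lemma coord1_last k (m : 'cV[nat]_k.+1) : coord1 m k.+1 = m ord_max 0.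
Proof. by rewrite (coord1_ext m (ltnSn k)); congr (m _ _); apply: val_inj. Qed.

(** * Residues up to sign *)

Section FoldedResidue.
Variable N : nat.
Hypothesis N0 : (0 < N)%N.

(** The representative in 0, ..., N of X modulo 2 N and up to sign. Here X stands for 2 mu and the
    result for 2 m, so that half-odd values need no separate treatment. *)
Definition fold2 (X : int) : nat :=
  let x := absz (X %% (2 * N)%N%:Z)%Z in if (x <= N)%N then x else (2 * N - x)%N.

Lemma fold2_le X : (fold2 X <= N)%N.
Proof. by rewrite /fold2; case: ifP => //; lia. Qed.

Lemma fold2_spec X : exists t, fold2 X = X + 2 * N%:Z * t :> int \/
  fold2 X = - X + 2 * N%:Z * t :> int.
Proof.
have D0 : (0 < (2 * N)%N%:Z)%R by lia.
have xE := divz_eq X (2 * N)%N; have x0 := modz_ge0 X (lt0r_neq0 D0).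
have xlt := ltz_pmod X D0; rewrite /fold2.
set y := (X %% _)%Z in xE x0 xlt *; set q := (X %/ _)%Z in xE.
case: ifP => yN; [exists (- q); left|exists (q + 1); right]; nia.
Qed.

Lemma eqpm_modE X (M : nat) : eqpm_mod N (X%:~R / 2) (M%:R / 2) <->
  exists t, M = X + 2 * N%:Z * t :> int \/ M = - X + 2 * N%:Z * t :> int.
Proof.
have NN : N%:R != 0 :> rat by rewrite pnatr_eq0 -lt0n.
have D0 : (0 < 2 * N)%N by lia.
rewrite /eqpm_mod.
have -> : (X%:~R / 2 - M%:R / 2) / N%:R = (X - M%:Z)%:~R / (2 * N)%N%:R :> rat.
  by rewrite rmorphB /= -pmulrn natrM; field.
have -> : (X%:~R / 2 + M%:R / 2) / N%:R = (X + M%:Z)%:~R / (2 * N)%N%:R :> rat.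
  by rewrite rmorphD /= -pmulrn natrM; field.
rewrite !intr_div_nat //; split=> [[[t tE]|[t tE]]|[t [tE|tE]]].
- by exists (- t); left; nia.
- by exists t; right; nia.
- by left; exists (- t); nia.
- by right; exists t; nia.
Qed.

Lemma fold2_uniq X (M : nat) : (M <= N)%N -> 
  eqpm_mod N (X%:~R / 2) (M%:R / 2) <-> M = fold2 X.
Proof.
move=> MN; rewrite eqpm_modE; split=> [|->]; last exact: fold2_spec.
have FN := fold2_le X; have [t tE] := fold2_spec X.
move=> [u uE]; move: (fold2 X) FN tE => F FN tE.
have [v vE] : exists v, M%:Z = F%:Z + 2 * N%:Z * v :> int \/ M%:Z = - F%:Z + 2 * N%:Z * v :> int.
  case: tE uE => tE [uE|uE].
  - by exists (u - t); left; lia.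
  - by exists (u + t); right; lia.
  - by exists (u + t); right; lia.
  - by exists (u - t); left; lia.
have [v0|[v0|v0]] : v <= -1 \/ 1 <= v \/ v = 0 by lia.
- by case: vE; nia.
- by case: vE; nia.
- by subst v; case: vE; lia.
Qed.

End FoldedResidue.

(** The sets Z i with i in I partition the integers, M z being the class of z; the double sum
    therefore collapses to a single one. *)
Lemma lsum_fibre (I : set nat) (g : nat -> lser) (Z : nat -> set int)
    (M : int -> nat) (h : int -> lser) :
  finite_set I -> summable h -> (forall z, I (M z)) ->
  (forall i z, I i -> Z i z <-> i = M z) ->
  lsum (fun i => if i \in I then g i * lsum (fun z => if z \in Z i then h z else 0)
                 else 0) =
  lsum (fun z => g (M z) * h z).
Proof.
move=> finI sh IM ZM.
pose F i z := if (i \in I) && (z \in Z i) then g i * h z else 0.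
have sF : summable (fun p : nat * int => F p.1 p.2).
  move=> e; have finU : finite_set (\bigcup_(i in I)
      ((fun z => (i, z)) @` [set z | ~ ordge e (g i * h z)])).
    apply: bigcup_finite => // i _; apply: finite_image.
    exact: (summableMl (g i) sh e).
  apply: sub_finite_set finU => -[i z] /=; rewrite /F.
  case: ifPn => [/andP[]|_ n0]; last by case: n0; exact: ordge0.
  by rewrite in_setE => Ii _ ne; exists i => //=; exists z.
transitivity (lsum (fun i => lsum (F i))).
  apply: eq_lsum => i; rewrite /F; case: ifP => iI /=; last by rewrite lsum0.
  rewrite -lsumMl; last exact: summable_if.
  by apply: eq_lsum => z; case: ifP; rewrite ?mulr0.
rewrite lsum_swap //; apply: eq_lsum => z.
rewrite (lsum1 (i0 := M z)) => [|i iM]; last first.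
  rewrite /F; case: ifP => // /andP[]; rewrite !in_setE => Ii.
  by move=> /(ZM _ _ Ii).
rewrite /F ifT //; apply/andP; rewrite !in_setE; split; first exact: IM.
by apply/(ZM _ _ (IM z)).
Qed.

(** * Bounds on the bosonic exponents *)

Section Exponents.
Variables (p p' r s : nat).
Hypotheses (hp : (0 < p)%N) (hpp' : (p < p')%N).
Hypotheses (hr : (1 <= r <= p - 1)%N) (hs : (1 <= s <= p' - 1)%N).

Definition expo1 (z : int) : int := z * (z * p%:Z * p'%:Z + r%:Z * p'%:Z - s%:Z * p%:Z).
Definition expo2 (z : int) : int := (z * p%:Z + r%:Z) * (z * p'%:Z + s%:Z).

(** Since |r p' - s p| < p p', the second factor has the sign of z and is nonzero for z <> 0. *)
Lemma expo1_ge z : `|z| <= expo1 z.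
Proof.
rewrite /expo1; have w1 : r%:Z * p'%:Z - s%:Z * p%:Z <= p%:Z * p'%:Z - 1 by nia.
have w2 : - (p%:Z * p'%:Z - 1) <= r%:Z * p'%:Z - s%:Z * p%:Z by nia.
have : 1 <= p%:Z * p'%:Z by nia.
have -> : z * p%:Z * p'%:Z + r%:Z * p'%:Z - s%:Z * p%:Z =
  z * (p%:Z * p'%:Z) + (r%:Z * p'%:Z - s%:Z * p%:Z) by lia.
move: (p%:Z * p'%:Z) (r%:Z * p'%:Z - s%:Z * p%:Z) w1 w2 => P w w1 w2 P1.
have [z0|[z0|z0]] : z <= -1 \/ z = 0 \/ 1 <= z by lia.
- have : z * P + w <= -1 by nia.
  by nia.
- by subst z; lia.
- have : 1 <= z * P + w by nia.
  by nia.
Qed.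

Lemma expo2_ge z : `|z| <= expo2 z.
Proof.
rewrite /expo2; have [z0|z0] : z <= -1 \/ 0 <= z by lia.
- have h1 : z * p%:Z + r%:Z <= z by nia.
  have h2 : z * p'%:Z + s%:Z <= -1 by nia.
  by nia.
- have h1 : z + 1 <= z * p%:Z + r%:Z by nia.
  have h2 : 1 <= z * p'%:Z + s%:Z by nia.
  by nia.
Qed.

End Exponents.

Section Charges.
Variables (p' s b : nat).
Hypotheses (hb : (1 <= b <= p' - 1)%N) (hs : (1 <= s <= p' - 1)%N).

Definition charge1 (z : int) : int := b%:Z - s%:Z + 2 * z * p'%:Z.
Definition charge2 (z : int) : int := b%:Z + s%:Z + 2 * z * p'%:Z.

(** As |b - s| < p', the charge nearest to 0 is the one at z = 0. This is the lambda of the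
    prefactor, and the bound keeps the exponents of the branching function nonnegative. *)
Lemma charge1_ge z : (b%:Z - s%:Z) ^+ 2 <= charge1 z ^+ 2.
Proof.
rewrite /charge1 !expr2.
have [z0|[z0|z0]] : z <= -1 \/ z = 0 \/ 1 <= z by lia.
- have : b%:Z - s%:Z + 2 * z * p'%:Z <= - `|b%:Z - s%:Z| by nia.
  by nia.
- by subst z; lia.
- have : `|b%:Z - s%:Z| <= b%:Z - s%:Z + 2 * z * p'%:Z by nia.
  by nia.
Qed.

Lemma charge2_ge z : (b%:Z - s%:Z) ^+ 2 <= charge2 z ^+ 2.
Proof.
rewrite /charge2 !expr2.
have [z0|z0] : z <= -1 \/ 0 <= z by lia.
- have : b%:Z + s%:Z + 2 * z * p'%:Z <= - `|b%:Z - s%:Z| by nia.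
  by nia.
- have : `|b%:Z - s%:Z| <= b%:Z + s%:Z + 2 * z * p'%:Z by nia.
  by nia.
Qed.

End Charges.

Lemma polyFE (p p' r s b L : nat) :
  let B := bosonic (expo1 p p' r s) (expo2 p p' r s) (charge1 p' s b) (charge2 p' s b) L in
  summable B -> polyF p p' r s L b = lpoch L * lsum B.
Proof.
move=> B sB.
rewrite -lsumMl //.
have -> : lsum (fun z => lpoch L * B z) =
  lsum (fun z => if z \in [set: int] then lpoch L * B z else 0).
  by apply: eq_lsum => z; rewrite in_setT.
rewrite -qsumE; last exact/summable_if/summableMl.
rewrite /polyF; congr qsum; apply/funext => z.
rewrite (@qbinom_bkernel L (charge1 p' s b z)); last first.
  by rewrite /charge1 !(rmorphB, rmorphD, rmorphM) /= -!pmulrn; field.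
rewrite (@qbinom_bkernel L (charge2 p' s b z)); last first.
  by rewrite /charge2 !(rmorphB, rmorphD, rmorphM) /= -!pmulrn; field.
have -> : lpoch L * B z =
   lq (expo1 p p' r s z)%:~R * (lpoch L * bkernel L (charge1 p' s b z)) -
   lq (expo2 p p' r s z)%:~R * (lpoch L * bkernel L (charge2 p' s b z)).
  rewrite /B /bosonic; move: (lpoch L) (lq _) (lq _) (bkernel _ _) (bkernel _ _).
  by move=> x1 x2 x3 x4 x5; ring.
rewrite lsubE !lmulE /expo1 /expo2 !(rmorphB, rmorphD, rmorphM) /= -!pmulrn.
by [].
Qed.

(** * Matching the two sides *)

Section Assembly.
Variables (p p' r s b k l : nat).
Hypotheses (hp : (0 < p)%N) (hpp' : (p < p')%N).
Hypotheses (hr : (1 <= r <= p - 1)%N) (hb : (1 <= b <= p' - 1)%N)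
  (hs : (1 <= s <= p' - 1)%N) (lk : (l <= k)%N).
Hypothesis hpar : ~~ odd (s + b + k.+1 * r + l).
Let N := k.+1.
Let d (i : nat) : int := (i == l)%:Z.
Let tau : int := ((l == 0) + r.+1)%N.
Let d01 i : 0 <= d i <= 1. Proof. by rewrite /d; case: eqP. Qed.

Local Notation e1 := (expo1 p p' r s).
Local Notation e2 := (expo2 p p' r s).
Local Notation a1 := (charge1 p' s b).
Local Notation a2 := (charge2 p' s b).

Definition weight_exp (a : int) : rat :=
  a%:~R ^+ 2 / (4 * N%:R) + l%:R * (N%:R - l%:R) / (4 * N%:R).

Lemma paraf_fold a X u :
  (X = a + N%:Z * r%:Z + 2 * N%:Z * u \/ X = - (a + N%:Z * r%:Z) + 2 * N%:Z * u) ->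
  paraf d tau k a = lq (weight_exp a) * string_sum k l (fold2 N X).
Proof.
move=> XE; have [t tE] := fold2_spec (ltn0Sn k) X.
have [[v vE]|[v vE]] : (exists v, fold2 N X = - a + N%:Z * r%:Z + 2 * N%:Z * v :> int) \/
    (exists v, fold2 N X = - - a + N%:Z * r%:Z + 2 * N%:Z * v :> int).
  case: XE tE => XE [tE|tE].
  - by right; exists (u + t); rewrite tE XE; lia.
  - by left; exists (t - u - r%:Z); rewrite tE XE; lia.
  - by left; exists (t + u - r%:Z); rewrite tE XE; lia.
  - by right; exists (t - u); rewrite tE XE; lia.
- by have [] := paraf_string lk vE.
- have [E _] := paraf_string lk vE.
  by rewrite -parafN // E /weight_exp rmorphN sqrrN.
Qed.

Lemma summable_string_term (M : int) :
  summable (fun n : 'cV[nat]_k => if n \in string_index l M then string_term l n else 0).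
Proof.
have ME : M = - (- M) + N%:Z * 0%N%:Z + 2 * N%:Z * 0 by lia.
by have [] := paraf_string lk ME.
Qed.

Definition rhs_exp : rat :=
  - ((l%:R * (N%:R - l%:R) + `|b%:R - s%:R| ^+ 2) / (4 * N%:R)).

Lemma fermionic_side :
  'q^(rhs_exp) **
  (\qsum_(m in [set m : 'cV[nat]_N |
                forall i, m i 0 = parityQ N l r i 0 %[mod 2]])
    (let n := nvec l m in
     'q^(4^-1 * bilin (ratv m) (cartanT N) (ratv m)) **
     \big[qmul/'q^(0)]_(1 <= j < N)
        qbinom (coord1 (ratv m) j + coord1 n j) (coord1 (ratv m) j) **
     (polyF p p' r s (coord1 m N) b ** qinv (qpoch (coord1 m N))))) =
  (lq rhs_exp * (hpoch_infty *
    (lsum (fun z => lq (e1 z)%:~R * paraf d tau k (a1 z)) -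
     lsum (fun z => lq (e2 z)%:~R * paraf d tau k (a2 z)))) : lser) :> qseries.
Proof.
have e1P := expo1_ge hp hpp' hr hs; have e2P := expo2_ge hp hpp' hr hs.
rewrite -(@lsum_fermionic_bosonic k l r _ _ a1 a2 e1P e2P).
pose B (m : 'cV[nat]_N) := lsum (bosonic e1 e2 a1 a2 (m ord_max 0%R)).
pose H (m : 'cV[nat]_N) := ext 0 m 0.
pose T (m : 'cV[nat]_N) := lq (4^-1 * bilin (ratv m) (cartanT N) (ratv m)) *
  \prod_(1 <= j < N) hbin (H m j.-1 + H m j.+1 + (j == l)%:Z) (H m j) * B m.
have TE m : (let n := nvec l m in
     'q^(4^-1 * bilin (ratv m) (cartanT N) (ratv m)) **
     \big[qmul/'q^(0)]_(1 <= j < N)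
        qbinom (coord1 (ratv m) j + coord1 n j) (coord1 (ratv m) j) **
     (polyF p p' r s (coord1 m N) b ** qinv (qpoch (coord1 m N)))) = T m.
  rewrite /= coord1_last polyFE; last exact: summable_bosonic.
  rewrite qpochE (qinv_linv (ordge_1sub_lpoch _)).
  rewrite -/(hpoch _) -lmulE.
  have -> : \big[qmul/'q^(0)]_(1 <= j < N)
        qbinom (coord1 (ratv m) j + coord1 (nvec l m) j) (coord1 (ratv m) j) =
      (\prod_(1 <= j < N) hbin (H m j.-1 + H m j.+1 + (j == l)%:Z) (H m j) : lser).
    rewrite lprodE; apply: eq_big_nat => j jN.
    rewrite coord1_nvec // coord1_ratv; last by lia.
    case: j jN => // j jN; have {}jN : (j < N)%N by lia.
    rewrite /H (ext_lt 0 m 0 jN) -pmulrn qbinom_hbin //.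
    have pos i : 0 <= ext 0 m 0 i by rewrite /ext; case: i => // i; case: insubP.
    by apply: addr_ge0 => //; apply: addr_ge0; exact: pos.
  rewrite -lqE -!lmulE /T -/(B m); congr lval.
  have := mul_hpoch (m ord_max 0); set x := lpoch _; set y := hpoch _ => xy.
  by rewrite [x * B m]mulrC -[B m * x * y]mulrA xy mulr1.
rewrite [qsum _ _](_ : _ = qsum (@fermionic_index k l r) (fun m => T m : qseries)).
  2: by congr qsum; apply/funext => m; exact: TE.
have tE (m : 'cV[nat]_N) : (if m \in fermionic_index l r then T m else 0) =
    cweight d tau k (ext 0 m 0) * B m.
  rewrite -(@fermionic_term k l r) /T; case: ifP => _ //.
  by rewrite mul0r.
have B0 m : ordge 0 (B m).
  apply: ordge_lsum => z; apply: ordgeB.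
    apply: ordgeMl (ordge_bkernel _ _); apply: ordgeW (ordge_lq _).
    by rewrite ler0z; have := e1P z; lia.
  apply: ordgeMl (ordge_bkernel _ _); apply: ordgeW (ordge_lq _).
  by rewrite ler0z; have := e2P z; lia.
rewrite qsumE; last first.
  have -> : (fun m => if m \in fermionic_index l r then T m else 0) =
    (fun m => cweight d tau k (ext 0 m 0) * B m) by apply/funext.
  exact: (summable_fermionic l r B0).
by rewrite (eq_lsum tE) -lqE -lmulE.
Qed.

Let P' := (p' + N * p)%N.
Let S := (b + N * r)%N.

Definition branch_res1 (z : int) : int := s%:Z - S%:Z + 2 * (P'%:Z * z).
Definition branch_res2 (z : int) : int := s%:Z + S%:Z + 2 * (P'%:Z * z).

Definition branch_exp1 (z : int) : rat := let j : rat := z%:~R in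
  j / N%:R * (j * p'%:R * P'%:R + P'%:R * s%:R - p'%:R * S%:R).
Definition branch_exp2 (z : int) : rat := let j : rat := z%:~R in
  1 / N%:R * ((j * P'%:R + S%:R) * (j * p'%:R + s%:R)).

Lemma N_neq0 : N%:R != 0 :> rat. Proof. by rewrite pnatr_eq0. Qed.

(** With P P' = p'^2 + N p p' and P' R - P S = p' (s - b) + N (s p - r p'), the exponent splits into
    the Gaussian of the charge and the exponent of F. Both linear terms have the opposite sign,
    whence -z. *)
Lemma branch_exp1E z : branch_exp1 z =
  rhs_exp + weight_exp (a1 (- z)) + (e1 (- z))%:~R.
Proof.
have N0 := N_neq0; rewrite /branch_exp1 /rhs_exp /weight_exp real_normK ?num_real //.
rewrite /expo1 /charge1 /P' /S !(rmorphB, rmorphD, rmorphM, rmorphN, natrD, natrM) /=.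
by rewrite -!pmulrn; field.
Qed.

Lemma branch_exp2E z : branch_exp2 z =
  rhs_exp + weight_exp (a2 z) + (e2 z)%:~R.
Proof.
have N0 := N_neq0; rewrite /branch_exp2 /rhs_exp /weight_exp real_normK ?num_real //.
rewrite /expo2 /charge2 /P' /S !(rmorphB, rmorphD, rmorphM, rmorphN, natrD, natrM) /=.
by rewrite -!pmulrn; field.
Qed.

Lemma rhs_weight_ge0 a : (b%:Z - s%:Z) ^+ 2 <= a ^+ 2 -> 0 <= rhs_exp + weight_exp a.
Proof.
move=> ba; have N0 := N_neq0; rewrite /rhs_exp /weight_exp real_normK ?num_real //.
have -> : - ((l%:R * (N%:R - l%:R) + (b%:R - s%:R) ^+ 2) / (4 * N%:R)) +
    (a%:~R ^+ 2 / (4 * N%:R) + l%:R * (N%:R - l%:R) / (4 * N%:R)) =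
    (a ^+ 2 - (b%:Z - s%:Z) ^+ 2)%:~R / (4 * N%:R) :> rat.
  by rewrite rmorphB /= !rmorphXn /= rmorphB /= -!pmulrn; field.
by rewrite divr_ge0 ?ler0z ?subr_ge0 // mulr_ge0 // ler0n.
Qed.

Lemma branch_exp1_ge z : `|z|%:~R <= branch_exp1 z.
Proof.
rewrite branch_exp1E; have := rhs_weight_ge0 (charge1_ge hb hs (- z)).
have := expo1_ge hp hpp' hr hs (- z); rewrite normrN -(ler_int rat); lra.
Qed.

Lemma branch_exp2_ge z : `|z|%:~R <= branch_exp2 z.
Proof.
rewrite branch_exp2E; have := rhs_weight_ge0 (charge2_ge hb hs z).
have := expo2_ge hp hpp' hr hs z; rewrite -(ler_int rat); lra.
Qed.

Lemma summable_branch (f : int -> rat) : (forall z, `|z|%:~R <= f z) ->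
  summable (fun z => lq (f z)).
Proof.
move=> fz; apply: summable_ge finite_int_abs _ => z.
exact: ordgeW (fz z) (ordge_lq _).
Qed.

Lemma branching_side : branching p' P' N s S l =
  (hpoch_infty *
   (lsum (fun z => string_sum k l (fold2 N (branch_res1 z)) * lq (branch_exp1 z)) -
    lsum (fun z => string_sum k l (fold2 N (branch_res2 z)) * lq (branch_exp2 z)))
   : lser) :> qseries.
Proof.
pose I : set nat := [set M | (M <= N)%N /\ ~~ odd (M + l)].
pose Z (X : int -> int) (M : nat) : set int :=
  [set z | eqpm_mod N ((X z)%:~R / 2) (M%:R / 2)].
pose L X f M := lsum (fun z => if z \in Z X M then lq (f z) else 0).
pose T (M : nat) := lq (string_exp N l) * hpoch_infty * string_sum k l M *
  (L branch_res1 branch_exp1 M - L branch_res2 branch_exp2 M).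
have s1 := summable_branch branch_exp1_ge; have s2 := summable_branch branch_exp2_ge.
have LE X f M (sf : summable (fun z => lq (f z))) :
    qsum (Z X M) (fun z => 'q^(f z)) = L X f M.
  by rewrite /L -qsumE //; exact: summable_if.
have finI : finite_set I.
  apply: sub_finite_set (finite_II N.+1) => M [MN _] /=; exact: MN.
have sI (f : nat -> lser) : summable (fun M => if M \in I then f M else 0).
  by apply: (summable_supp finI) => M; case: ifP => //; rewrite in_setE.
have res1 z : (branch_res1 z)%:~R / 2 = (s%:R - S%:R) / 2 + P'%:R * z%:~R :> rat.
  by rewrite /branch_res1 !(rmorphB, rmorphD, rmorphM) /= -!pmulrn; field.
have E1 M : [set z : int | eqpm_mod N ((s%:R - S%:R) / 2 + P'%:R * z%:~R) (M%:R / 2)] =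
    Z branch_res1 M.
  by rewrite /Z; congr mkset; apply/funext => z; rewrite res1.
have res2 z : (branch_res2 z)%:~R / 2 = (s%:R + S%:R) / 2 + P'%:R * z%:~R :> rat.
  by rewrite /branch_res2 !(rmorphB, rmorphD, rmorphM) /= -!pmulrn; field.
have E2 M : [set z : int | eqpm_mod N ((s%:R + S%:R) / 2 + P'%:R * z%:~R) (M%:R / 2)] =
    Z branch_res2 M.
  by rewrite /Z; congr mkset; apply/funext => z; rewrite res2.
rewrite /branching.
rewrite [qsum _ _](_ : _ = qsum I (fun M => T M : qseries)); last first.
  congr qsum; apply/funext => M.
  rewrite (string_funE (summable_string_term M)) /T [RHS]lmulE lsubE -!LE //.
  by rewrite -E1 -E2.
rewrite qsumE // -lqE -lmulE; congr lval.
have TE M : (if M \in I then T M else 0) = lq (string_exp N l) * hpoch_infty *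
   ((if M \in I then string_sum k l M * L branch_res1 branch_exp1 M else 0) -
    (if M \in I then string_sum k l M * L branch_res2 branch_exp2 M else 0)).
  rewrite /T; case: ifP => _; last by rewrite subrr mulr0.
  by rewrite -mulrBr mulrA.
rewrite (eq_lsum TE) lsumMl; last exact: summableB.
(* The normalization of the branching function cancels the power of q in front of the string
   function. *)
rewrite lsumB // mulrA mulrA -lqD addNr lq0 mul1r.
(* Folding preserves parity, and s + S + l is even by hypothesis, so every residue falls on an index
   of the outer sum. *)
have foldI X : (exists t : int, X = s%:Z + S%:Z + 2 * t) -> I (fold2 N X).
  move=> [t XE]; split; first exact: fold2_le.
  have [u uE] := fold2_spec (ltn0Sn k) X; move: hpar uE; rewrite XE /S.
  have -> : (s + b + k.+1 * r + l = s + (b + N * r) + l)%N by rewrite /N; lia.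
  move: (fold2 _ _) => F; move: (b + N * r)%N => Y.
  have -> : 2 * k.+1%:Z * u = 2 * (k.+1%:Z * u) by rewrite mulrA.
  by move: (k.+1%:Z * u) => w; lia.
rewrite (lsum_fibre (fun M : nat => string_sum k l M) finI s1
  (M := fun z => fold2 N (branch_res1 z))); last 2 first.
- move=> z; apply: foldI; exists (P'%:Z * z - S%:Z); rewrite /branch_res1; lia.
- by move=> M z [MN _]; exact: fold2_uniq.
rewrite (lsum_fibre (fun M : nat => string_sum k l M) finI s2
  (M := fun z => fold2 N (branch_res2 z))) //.
- by move=> z; apply: foldI; exists (P'%:Z * z); rewrite /branch_res2; lia.
- by move=> M z [MN _]; exact: fold2_uniq.
Qed.

Lemma branch_term1 z : string_sum k l (fold2 N (branch_res1 (- z))) * lq (branch_exp1 (- z)) =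
  lq rhs_exp * (lq (e1 z)%:~R * paraf d tau k (a1 z)).
Proof.
rewrite (@paraf_fold (a1 z) (branch_res1 (- z)) (- (p%:Z * z))); last first.
  right; rewrite /branch_res1 /charge1 /P' /S; lia.
rewrite branch_exp1E opprK !lqD.
by move: (lq _) (lq _) (lq _) (string_sum _ _ _) => x1 x2 x3 x4; ring.
Qed.

Lemma branch_term2 z : string_sum k l (fold2 N (branch_res2 z)) * lq (branch_exp2 z) =
  lq rhs_exp * (lq (e2 z)%:~R * paraf d tau k (a2 z)).
Proof.
rewrite (@paraf_fold (a2 z) (branch_res2 z) (p%:Z * z)); last first.
  left; rewrite /branch_res2 /charge2 /P' /S; lia.
rewrite branch_exp2E !lqD.
by move: (lq _) (lq _) (lq _) (string_sum _ _ _) => x1 x2 x3 x4; ring.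
Qed.

Lemma branching_fermionic : branching p' P' N s S l =
  'q^(rhs_exp) **
  (\qsum_(m in [set m : 'cV[nat]_N |
                forall i, m i 0 = parityQ N l r i 0 %[mod 2]])
    (let n := nvec l m in
     'q^(4^-1 * bilin (ratv m) (cartanT N) (ratv m)) **
     \big[qmul/'q^(0)]_(1 <= j < N)
        qbinom (coord1 (ratv m) j + coord1 n j) (coord1 (ratv m) j) **
     (polyF p p' r s (coord1 m N) b ** qinv (qpoch (coord1 m N))))).
Proof.
rewrite fermionic_side branching_side; congr lval.
have s1 := summable_lq_abs (expo1_ge hp hpp' hr hs) (fun z => ordge_paraf d tau k (a1 z)).
have s2 := summable_lq_abs (expo2_ge hp hpp' hr hs) (fun z => ordge_paraf d tau k (a2 z)).
have E1 z := branch_term1 z; have E2 z := branch_term2 z.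
have -> : lsum (fun z => string_sum k l (fold2 N (branch_res1 z)) * lq (branch_exp1 z)) =
    lq rhs_exp * lsum (fun z => lq (e1 z)%:~R * paraf d tau k (a1 z)).
  rewrite -lsumMl // [RHS](lsum_reindex_bij (h := fun z : int => - z)).
  - by apply: eq_lsum => z; rewrite -E1 opprK.
  - exact (summableMl (lq rhs_exp) s1).
  - by exists (fun z => - z) => z; rewrite opprK.
have -> : lsum (fun z => string_sum k l (fold2 N (branch_res2 z)) * lq (branch_exp2 z)) =
    lq rhs_exp * lsum (fun z => lq (e2 z)%:~R * paraf d tau k (a2 z)).
  by rewrite -lsumMl //; apply: eq_lsum => z; exact: E2.
by rewrite -mulrBr mulrCA.
Qed.

End Assembly.

Theorem mainTheorem3 (p p' r s b N l : nat)
  (hp : (0 < p)%N) (hpp' : (p < p')%N) (hp'2p : (p' < 2 * p)%N)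
  (hcop : coprime p p')
  (hr : (1 <= r <= p - 1)%N)
  (hb : (1 <= b <= p' - 1)%N) (hs : (1 <= s <= p' - 1)%N)
  (hN : (1 <= N)%N) (hl : (l < N)%N)
  (hpar : ~~ odd (s + b + N * r + l)) :
  let lambda : rat := `|b%:R - s%:R| in
  branching p' (p' + N * p) N s (b + N * r) l =
  'q^(- ((l%:R * (N%:R - l%:R) + lambda ^+ 2) / (4 * N%:R))) **
  \qsum_(m in [set m : 'cV[nat]_N |
                forall i, m i 0 = parityQ N l r i 0 %[mod 2]])
    (let n := nvec l m in
     'q^(4^-1 * bilin (ratv m) (cartanT N) (ratv m)) **
     \big[qmul/'q^(0)]_(1 <= j < N)
        qbinom (coord1 (ratv m) j + coord1 n j) (coord1 (ratv m) j) **
     (polyF p p' r s (coord1 m N) b ** qinv (qpoch (coord1 m N)))).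
Proof.
case: N hN hl hpar => // k _ lk hpar.
exact: branching_fermionic.
Qed.
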